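(* Consider the collision-channel network with 2 CUs, 2 eRRHs and 2 CPs under a non-oblivious stationary randomized (NSR) policy with parameters $b_k^{(n)}$, $r_1\ge r_2$ and threshold $z$, satisfying $b_k^{(1)}+b_k^{(2)}=1$ for $k\in\{1,2\}$. Then the average AoI of the eRRHs has the closed form $$L_e=\frac14\sum_{n=1}^{2}\sum_{k=1}^{2}\sum_{\phi\in\mathcal{G}_n^z}F_{nk}^c(\phi)\,\pi_\phi^c,$$ where, for each $n$, $\pi^c=(\pi^c_\phi)_{\phi\in\mathcal{G}_n^z}$ is the steady-state distribution determined by the transition probability matrix $\mathbf{P}^c$ given in the context, and $F_{nk}^c$ is given by the linear system $$F_{nk}^c(\phi)=1+\sum_{\phi'\in\mathcal{G}_n^z,\ \phi_k'\ne1}\mathbf{P}^c_{\phi\phi'}F^c_{nk}(\phi'),\qquad\phi\in\mathcal{G}_n^z.$$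
   Context: Time is slotted, $t=0,1,2,\dots$; $m,n,k\in\{1,2\}$ index content users (CUs), eRRHs and content providers (CPs). Policy parameters: $b_k^{(n)}\in[0,1]$; $r_1\ge r_2$ in $[0,1]$, $r=r_1+r_2$; a predefined integer threshold $z$. Put $\zeta_{nk}^c=b_k^{(n)}(1-b_k^{(n)})$. In slot $t$, $\beta_{mk}^{(n)}(t)\in\{0,1\}$ indicates that CU $m$ sends a request for CP $k$ to eRRH $n$; $\sum_n\beta_{mk}^{(n)}(t)\le1$, $\Pr(\beta_{mk}^{(n)}(t)=1)=b_k^{(n)}$, and decisions of different CUs $m$ are independent. When eRRH $n$ receives a request for CP $k$, it either commands CP $k$ to send a new packet ($\gamma_{nk}(t)=1$) or uses its cached packet ($\gamma_{nk}(t)=0$); the $\gamma_{nk}(t)$ are independent over $n$ and over $k$, and $\Pr(\gamma_{nk}(t)=1)=r_{nk}(t)$, where $r_{nk}(t)=r_k$ if $g_{n1}(t)\ge g_{n2}(t)$ and $g_{n2}(t)<z$; $r_{nk}(t)=r-r_k$ if $g_{n1}(t)<g_{n2}(t)$ and $g_{n1}(t)<z$; $r_{nk}(t)=r/2$ if $g_{n1}(t)\ge z$ and $g_{n2}(t)\ge z$. Collisions: when two CUs simultaneously request the same CP from the same eRRH a collision occurs, so a request for CP $k$ is successfully received at an eRRH only if it is issued by a single CU; requests for different CPs at the same eRRH do not collide. AoI at the eRRHs: $g_{nk}(0)=1$; $g_{nk}(t+1)=1$ if $\gamma_{nk}(t)\sum_m\beta_{mk}^{(n)}(t)=1$ (probability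 $2\zeta_{nk}^cr_{nk}(t)$), and $g_{nk}(t+1)=g_{nk}(t)+1$ otherwise. The average AoI of the eRRHs is $L_e=\lim_{T\to\infty}\frac1T\sum_{t=1}^T\frac14\sum_{n=1}^2\sum_{k=1}^2\mathbb{E}[g_{nk}(t)]$. Truncated chain: $(g_{n1}^z(t),g_{n2}^z(t))$, where $g_{nk}^z(t+1)=1$ with probability $2\zeta_{nk}^cr_{nk}(t)$ and $g_{nk}^z(t+1)=\min\{g_{nk}^z(t)+1,z\}$ otherwise. It is a Markov process whose state space $\mathcal{G}_n^z$ consists of the $z^2$ pairs $\phi=(\phi_1,\phi_2)\in\{1,\dots,z\}^2$. $F^c_{nk}(\phi)$ is the expected time until eRRH $n$ next receives a new packet from CP $k$, given that the truncated state is $\phi$. Transition matrix $\mathbf{P}^c$: write $\xi_{nk}=2\zeta_{nk}^c$, $\bar\xi_{nk}=1-\xi_{nk}$, $r_0=r/2$, $\bar r_j=1-r_j$ ($j=0,1,2$), and partition the states $\phi$ into $\mathcal{G}_1^z=\{\phi_2<\phi_1\}$, $\mathcal{G}_2^z=\{\phi_1<\phi_2\}$, $\mathcal{G}_3^z=\{\phi_1=\phi_2\}$. The possible transitions $\phi\to\phi'$ are: (A) $\phi'=(1,1)$: $\mathbf{P}^c_{\phi\phi'}=r_0^2\xi_{n1}\xi_{n2}$ for $\phi\in\mathcal{G}_3^z$, and $r_1r_2\xi_{n1}\xi_{n2}$ for $\phi\in\mathcal{G}_1^z\cup\mathcal{G}_2^z$. (B) $\phi'=(1,\min\{\phi_2+1,z\})$: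 $r_0\xi_{n1}(\bar r_0\xi_{n2}+\bar\xi_{n2})$ for $\phi\in\mathcal{G}_3^z$; $r_1\xi_{n1}(\bar r_2\xi_{n2}+\bar\xi_{n2})$ for $\phi\in\mathcal{G}_1^z$; $r_2\xi_{n1}(\bar r_1\xi_{n2}+\bar\xi_{n2})$ for $\phi\in\mathcal{G}_2^z$. (C) $\phi'=(\min\{\phi_1+1,z\},1)$: $r_0\xi_{n2}(\bar r_0\xi_{n1}+\bar\xi_{n1})$ for $\phi\in\mathcal{G}_3^z$; $r_2\xi_{n2}(\bar r_1\xi_{n1}+\bar\xi_{n1})$ for $\phi\in\mathcal{G}_1^z$; $r_1\xi_{n2}(\bar r_2\xi_{n1}+\bar\xi_{n1})$ for $\phi\in\mathcal{G}_2^z$. (D) $\phi'=(\min\{\phi_1+1,z\},\min\{\phi_2+1,z\})$: $(\bar r_0\xi_{n1}+\bar\xi_{n1})(\bar r_0\xi_{n2}+\bar\xi_{n2})$ for $\phi\in\mathcal{G}_3^z$; $(\bar r_1\xi_{n1}+\bar\xi_{n1})(\bar r_2\xi_{n2}+\bar\xi_{n2})$ for $\phi\in\mathcal{G}_1^z$; $(\bar r_2\xi_{n1}+\bar\xi_{n1})(\bar r_1\xi_{n2}+\bar\xi_{n2})$ for $\phi\in\mathcal{G}_2^z$.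
   Formalization: Policy (r_k) and matrix (r/2) disagree at equal ages below z, making the claim false for r_1>r_2; it is proved for both consistent versions (policy as given with matrix corrected, or matrix as given with policy r/2 at ties). Also z≥2 is assumed, as the formula fails for z=1. *)

(* Defs.v *)
From HB Require Import structures.
From mathcomp Require Import all_boot all_order all_algebra.
From mathcomp Require Import all_classical all_reals all_analysis.
Set Implicit Arguments.
Unset Strict Implicit.
Unset Printing Implicit Defensive.
Import Order.TTheory GRing.Theory Num.Theory.
Import numFieldNormedType.Exports.
Local Open Scope classical_set_scope.
Local Open Scope ring_scope.

(* Indices m (CU), n (eRRH), k (CP) range over 'I_2; ord0 stands for index 1
   and ord_max for index 2. *)
Notation idx1 := (ord0 : 'I_2).
Notation idx2 := (ord_max : 'I_2).

(* x t m n k : in slot t, CU m requests CP k from eRRH n. *)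
Definition requests := nat -> 'I_2 -> 'I_2 -> 'I_2 -> bool.
(* c t n k : in slot t, eRRH n commands CP k to send a new packet. *)
Definition commands := nat -> 'I_2 -> 'I_2 -> bool.

(* No capture under collision: exactly one CU must issue the request. *)
Definition received (x : requests) (c : commands) (n k : 'I_2) (t : nat) : bool :=
  (c t n k * \sum_(m < 2) x t m n k == 1)%N.

Fixpoint aoi (x : requests) (c : commands) (n k : 'I_2) (t : nat) : nat :=
  if t is s.+1 then
    if received x c n k s then 1%N else (aoi x c n k s).+1
  else 1%N.

(* Treatment of two equal ages below the threshold z.  The case
   "g1 >= g2 and g2 < z" of the policy commands CP k with probability r_k
   (TiesFirst), whereas the rows phi1 = phi2 < z of the transition matrix use
   the even split r/2 for both CPs (TiesEven).  The two agree only if r1 = r2;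
   either convention is carried through both the policy and the matrix. *)
Variant tie_rule := TiesFirst | TiesEven.

Definition is_even (tie : tie_rule) : bool :=
  if tie is TiesEven then true else false.

(* r_{nk}(t), as a function of the current ages g1, g2 at the eRRH. *)
Definition command_prob (R : realType) (tie : tie_rule) (r1 r2 : R) (z : nat)
    (g1 g2 : nat) (k : 'I_2) : R :=
  let r := r1 + r2 in
  let rk := if k == idx1 then r1 else r2 in
  if [&& is_even tie, g1 == g2 & g2 < z]%N then r / 2
  else if ((g2 <= g1) && (g2 < z))%N then rk
  else if ((g1 < g2) && (g1 < z))%N then r - rk
  else r / 2.

Definition bernoulli_weight (R : realType) (p : R) (b : bool) : R :=
  if b then p else 1 - p.

Section Network.
Context (d : measure_display) (T : measurableType d) (R : realType).
Implicit Types (P : probability T R).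
Implicit Types (beta : nat -> 'I_2 -> 'I_2 -> 'I_2 -> T -> bool).
Implicit Types (gamma : nat -> 'I_2 -> 'I_2 -> T -> bool).

Definition history beta gamma (x : requests) (c : commands) (t : nat) : set T :=
  [set w | forall s, (s < t)%N ->
     (forall m n k, beta s m n k w = x s m n k) /\
     (forall n k, gamma s n k w = c s n k)].

(* [nsr_law] is the chain rule for the law of the finite histories: in every
   slot, independently of the past, the requests for different (m, k) are
   independent, and given the past the commands are independent of the requests
   and of each other, with parameters r_{nk}(t) computed from the ages. *)
Record nsr_network P (b : 'I_2 -> 'I_2 -> R) (r1 r2 : R) (z : nat)
    (tie : tie_rule) beta gamma : Prop := NSRNetwork {
  nsr_measurable_beta : forall t m n k, measurable_fun setT (beta t m n k);
  nsr_measurable_gamma : forall t n k, measurable_fun setT (gamma t n k);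
  nsr_one_request : forall t m k w, (\sum_(n < 2) beta t m n k w <= 1)%N;
  nsr_request_prob : forall t m n k,
    P [set w | beta t m n k w = true] = (b n k)%:E;
  nsr_law : forall (x : requests) (c : commands) (t : nat),
    P (history beta gamma x c t.+1) =
    (P (history beta gamma x c t) *
     \prod_(m < 2) \prod_(k < 2)
       P [set w | forall n, beta t m n k w = x t m n k] *
     (\prod_(n < 2) \prod_(k < 2)
       bernoulli_weight
         (command_prob tie r1 r2 z (aoi x c n idx1 t) (aoi x c n idx2 t) k)
         (c t n k))%R%:E)%E
}.

Definition receipt beta gamma (n k : 'I_2) (t : nat) (w : T) : bool :=
  received (fun s m n k => beta s m n k w) (fun s n k => gamma s n k w) n k t.

Definition age beta gamma (n k : 'I_2) (t : nat) (w : T) : nat :=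
  aoi (fun s m n k => beta s m n k w) (fun s n k => gamma s n k w) n k t.

(* The average AoI L_e of the eRRHs is the limit of this sequence. *)
Definition average_age P beta gamma (N : nat) : \bar R :=
  ((N%:R^-1)%:E * \sum_(1 <= t < N.+1)
     ((4^-1)%:E * \sum_(n < 2) \sum_(k < 2)
        'E_P[fun w => (age beta gamma n k t w)%:R : R]))%E.

(* A packet received in slot t + j - 1 resets the age at time t + j; the value
   is +oo if there is no further reception. *)
Definition waiting_time beta gamma (n k : 'I_2) (t : nat) (w : T) : \bar R :=
  ereal_inf [set (j%:R : R)%:E | j in
    [set j : nat | (0 < j)%N /\ receipt beta gamma n k (t + j).-1 w]].

End Network.

(* {1, ..., z}^2, with components shifted by one; see [level]. *)
Definition state (z : nat) := {ffun 'I_2 -> 'I_z}.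

Definition level (z : nat) (phi : state z) (k : 'I_2) : nat := (phi k).+1.

(* The truncated ages of eRRH n are in state phi at time t. *)
Definition in_state (d : measure_display) (T : measurableType d) (z : nat)
    (beta : nat -> 'I_2 -> 'I_2 -> 'I_2 -> T -> bool)
    (gamma : nat -> 'I_2 -> 'I_2 -> T -> bool)
    (n : 'I_2) (t : nat) (phi : state z) : set T :=
  [set w | forall k, minn (age beta gamma n k t w) z = level phi k].

Section Chain.
Context (R : realType) (z : nat).
Implicit Types (phi : state z).

Definition xi (b : 'I_2 -> 'I_2 -> R) (n k : 'I_2) : R :=
  2 * (b n k * (1 - b n k)).

(* The pair (p1, p2) such that each transition probability out of phi is given
   by one formula in p1, p2: (r1, r2) on phi2 < phi1, (r2, r1) on phi1 < phi2
   and, up to the tie rule, (r0, r0) on phi1 = phi2. *)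
Definition class_probs (tie : tie_rule) (r1 r2 : R) phi : R * R :=
  let r0 := (r1 + r2) / 2 in
  let l1 := level phi idx1 in
  let l2 := level phi idx2 in
  if (l2 < l1)%N then (r1, r2)
  else if (l1 < l2)%N then (r2, r1)
  else if ~~ is_even tie && (l1 < z)%N then (r1, r2)
  else (r0, r0).

(* The four target states are distinct as soon as z >= 2. *)
Definition Pc (b : 'I_2 -> 'I_2 -> R) (r1 r2 : R) (tie : tie_rule) (n : 'I_2)
    (phi phi' : state z) : R :=
  let: (p1, p2) := class_probs tie r1 r2 phi in
  let xi1 := xi b n idx1 in
  let xi2 := xi b n idx2 in
  let q1 := (1 - p1) * xi1 + (1 - xi1) in
  let q2 := (1 - p2) * xi2 + (1 - xi2) in
  let up1 := minn (level phi idx1).+1 z in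
  let up2 := minn (level phi idx2).+1 z in
  let to l1 l2 := (level phi' idx1 == l1) && (level phi' idx2 == l2) in
  if to 1%N 1%N then p1 * p2 * xi1 * xi2
  else if to 1%N up2 then p1 * xi1 * q2
  else if to up1 1%N then p2 * xi2 * q1
  else if to up1 up2 then q1 * q2
  else 0.

Definition stationary (M : state z -> state z -> R)
    (p : {ffun state z -> R}) : Prop :=
  [/\ forall phi, 0 <= p phi, \sum_phi p phi = 1 &
      forall phi', \sum_phi p phi * M phi phi' = p phi'].

(* Probability that the chain M started from phi first enters a state with
   k-th component 1 (that is, eRRH n first receives a new packet from CP k) at
   step j + 1. *)
Fixpoint first_reset (M : state z -> state z -> R) (k : 'I_2) (j : nat)
    phi : R :=
  if j is i.+1 then
    \sum_(phi' | level phi' k != 1%N) M phi phi' * first_reset M k i phi'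
  else \sum_(phi' | level phi' k == 1%N) M phi phi'.

(* Expected value of that step, worth +oo if no such state is ever entered. *)
Definition expected_reset (M : state z -> state z -> R) (k : 'I_2) phi
    : \bar R :=
  (\sum_(0 <= j <oo) (j.+1%:R * first_reset M k j phi)%R%:E
   + +oo * (1 - \sum_(0 <= j <oo) (first_reset M k j phi)%:E))%E.

Definition reset_system (M : state z -> state z -> R) (k : 'I_2)
    (F : state z -> \bar R) : Prop :=
  forall phi, F phi =
    (1 + \sum_(phi' | level phi' k != 1%N) (M phi phi')%:E * F phi')%E.

End Chain.

(* Main.v *)
Require Import Defs.
From mathcomp Require Import all_boot all_order all_algebra.
From mathcomp Require Import all_classical all_reals all_analysis.
From mathcomp Require Import measurable_realfun zify ring lra.
Set Implicit Arguments.
Unset Strict Implicit.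
Unset Printing Implicit Defensive.
Import Order.TTheory GRing.Theory Num.Theory.
Import numFieldNormedType.Exports.
Local Open Scope classical_set_scope.
Local Open Scope ring_scope.

(* Fix n and k, and let S_j(phi) be the probability that the chain started at
   phi makes j steps without a reset of component k.  By Abel summation the
   expected reset time is F = sum_j S_j, in which form the linear system and its
   uniqueness are immediate.  Conditionally on the past, the receipts from the
   two CPs in a slot are independent with probabilities p_k xi_k, by which the
   truncated ages form a Markov chain with matrix Pc; hence
     E[g(t)] = sum_(j <= t) P(g(t) > j) = sum_(j <= t) mu_(t-j) . S_j,
   where mu_t is the law of the truncated state at time t.
   As xi_k <= 1/2, the step that increases both ages always has positive
   probability, and z such steps lead to (z, z).  The maximum principle then
   shows that I - Pc + 1 e_(z,z) is invertible, which gives the stationary law pi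
   and a solution of Poisson's equation u - Pc u = F - pi F when F is finite; with
   it the sum of E[g(t)] over t <= N telescopes to N (pi F) + O(1).  F is infinite
   only when no reset of k is ever possible, and then E[g(t)] = t + 1. *)

(** * Finite Markov chains *)

Lemma sum_enum_val (R : nmodType) (I : finType) (F : I -> R) :
  \sum_x F x = \sum_(i < #|I|) F (enum_val i).
Proof. by rewrite -(big_enum_val (fun x => F x)); apply: eq_bigl => x. Qed.

(** A square matrix with trivial kernel is invertible, so its actions on functions and on measures
    are both onto. [B] is the transpose of [A], so that the row vectors of [inj_row_free] play the
    role of functions. *)
Lemma fin_linear_surj (R : fieldType) (I : finType) (A : I -> I -> R) :
    (forall u : I -> R,
       (forall x, \sum_y A x y * u y = 0) -> forall x, u x = 0) ->
  (forall f : I -> R, exists u : I -> R, forall x, \sum_y A x y * u y = f x) /\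
  (forall f : I -> R, exists p : I -> R, forall y, \sum_x p x * A x y = f y).
Proof.
move=> injA.
pose B := \matrix_(i < #|I|, j < #|I|) A (enum_val j) (enum_val i).
have Bunit : B \in unitmx.
  rewrite -row_free_unit; apply: inj_row_free => v vB0.
  have u0 x : v 0 (enum_rank x) = 0.
    apply: (injA (fun x => v 0 (enum_rank x))) => {}x.
    transitivity ((v *m B) 0 (enum_rank x)); last by rewrite vB0 mxE.
    rewrite mxE sum_enum_val; apply: eq_bigr => j _.
    by rewrite !mxE enum_valK enum_rankK mulrC.
  by apply/rowP => i; rewrite !mxE -(enum_valK i) u0.
split=> f.
  pose w := \row_(i < #|I|) f (enum_val i); pose v := w *m invmx B.
  exists (fun x => v 0 (enum_rank x)) => x.
  have := congr1 (fun w : 'rV_#|I| => w 0 (enum_rank x)) (mulmxKV Bunit w).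
  rewrite /= -/v !mxE enum_rankK => <-; rewrite sum_enum_val.
  by apply: eq_bigr => j _; rewrite !mxE enum_valK enum_rankK mulrC.
pose w := \col_(i < #|I|) f (enum_val i); pose v := invmx B *m w.
exists (fun x => v (enum_rank x) 0) => x.
have := congr1 (fun w : 'cV_#|I| => w (enum_rank x) 0) (mulKVmx Bunit w).
rewrite /= -/v !mxE enum_rankK => <-; rewrite sum_enum_val.
by apply: eq_bigr => j _; rewrite !mxE enum_valK enum_rankK mulrC.
Qed.

(** * Maximum principle, Poisson's equation and the stationary law *)

Section MarkovChain.
Context (R : realFieldType) (I : finType) (M : I -> I -> R).
Hypothesis M_ge0 : forall x y, 0 <= M x y.
Hypothesis M_sum : forall x, \sum_y M x y = 1.
Implicit Types (u f : I -> R).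

Section Atom.
Variables (up : I -> I) (K : nat) (x0 : I).
Hypothesis M_up : forall x, 0 < M x (up x).
Hypothesis iter_up : forall x, iter K up x = x0.

(** At a maximiser of [u] the nonnegative differences to its successors average to at most 0, so
    each successor of positive probability is again a maximiser. Following [up] for [K] steps leads
    to [x0]. *)
Lemma subharmonic_le u :
  (forall x, u x <= \sum_y M x y * u y) -> forall x, u x <= u x0.
Proof.
move=> sub; have [x _ xmax] := arg_maxP u (erefl true : xpredT x0).
have stepmax y : u y = u x -> u (up y) = u x.
  move=> uyx; have nonneg i : true -> 0 <= M y i * (u x - u i).
    by move=> _; rewrite mulr_ge0// subr_ge0; exact: xmax.
  have := sub y; rewrite -subr_le0 uyx => le0.
  have : \sum_i M y i * (u x - u i) <= 0.
    under eq_bigr do rewrite mulrBr.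
    by rewrite sumrB -mulr_suml M_sum mul1r.
  move=> le0'; have sum0 : \sum_i M y i * (u x - u i) = 0.
    by apply/eqP; rewrite eq_le le0' sumr_ge0.
  have : M y (up y) * (u x - u (up y)) = 0 by exact: (psumr_eq0P nonneg sum0).
  by move/eqP; rewrite mulf_eq0 gt_eqF//= subr_eq0 => /eqP.
have -> : u x0 = u x.
  by rewrite -(iter_up x); elim: K => //= n; exact: stepmax.
by move=> y; exact: xmax.
Qed.

(** If [u x0] is nonnegative, the equation makes [u] subharmonic, hence maximal at [x0]; read at
    [x0] it then forces [u x0 = 0] and [u <= 0]. The same argument for [-u] gives the other sign. *)
Lemma atom_injective u :
  (forall x, u x - \sum_y M x y * u y + u x0 = 0) -> forall x, u x = 0.
Proof.
have ge0 v : (forall x, v x - \sum_y M x y * v y + v x0 = 0) -> 0 <= v x0 ->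
    v x0 = 0 /\ forall x, v x <= 0.
  move=> vE v0; have vle : forall x, v x <= v x0.
    by apply: subharmonic_le => x; move: (vE x) v0; lra.
  have Mv : \sum_y M x0 y * v y <= v x0.
    rewrite -[leRHS]mul1r -(M_sum x0) mulr_suml.
    by apply: ler_sum => y _; rewrite ler_wpM2l.
  have v00 : v x0 = 0 by apply/eqP; rewrite eq_le v0 andbT; move: (vE x0) Mv; lra.
  by split=> // x; rewrite -v00.
have opp v : (forall x, v x - \sum_y M x y * v y + v x0 = 0) ->
    forall x, - v x - \sum_y M x y * - v y + - v x0 = 0.
  move=> vE x; under eq_bigr do rewrite mulrN.
  by rewrite sumrN; move: (vE x); lra.
move=> uE x; have u00 : u x0 = 0.
  have [/(ge0 _ uE)[]//|u_lt0] := leP 0 (u x0).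
  have [|] := ge0 _ (opp _ uE); first by lra.
  by lra.
have [|_ le0] := ge0 _ uE; first by rewrite u00.
have [|_ ge0'] := ge0 _ (opp _ uE); first by rewrite u00 oppr0.
by move: (le0 x) (ge0' x); lra.
Qed.

(** The matrix I - M + 1 e_(x0): the rank-one term removes the constants from the kernel of I -
    M. *)
Let A x y := (y == x)%:R - M x y + (y == x0)%:R.

Let sum_delta u x : \sum_y (y == x)%:R * u y = u x.
Proof.
rewrite (bigD1 x)//= eqxx mul1r big1 ?addr0// => y /negbTE ->.
by rewrite mul0r.
Qed.

Let AE u x : \sum_y A x y * u y = u x - \sum_y M x y * u y + u x0.
Proof.
under eq_bigr do rewrite /A mulrDl mulrBl.
by rewrite big_split sumrB/= !sum_delta.
Qed.

Lemma poisson_solution f :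
  exists u, forall x, u x - \sum_y M x y * u y + u x0 = f x.
Proof.
have [|+ _] := @fin_linear_surj R I A.
  by move=> u uE; apply: atom_injective => x; rewrite -AE.
by move=> /(_ f)[u uE]; exists u => x; rewrite -AE.
Qed.

(** Pairing with an invariant law cancels [u - M u]. Thus the constant [u x0] in Poisson's equation
    is the stationary mean of the right-hand side. *)
Lemma stationary_functional p u :
    \sum_x p x = 1 -> (forall y, \sum_x p x * M x y = p y) ->
  \sum_x p x * (u x - \sum_y M x y * u y + u x0) = u x0.
Proof.
move=> p1 pM; under eq_bigr do rewrite mulrDr mulrBr mulr_sumr.
rewrite big_split sumrB/= -mulr_suml p1 mul1r exchange_big/=.
rewrite [X in _ - X](_ : _ = \sum_x p x * u x) ?subrr ?add0r//.
by apply: eq_bigr => y _; rewrite -pM mulr_suml; apply: eq_bigr => x _; rewrite mulrA.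
Qed.

(** Both values at [x] are the constant [u x0] of the solution of Poisson's equation whose
    right-hand side is the indicator of [x]. *)
Lemma stationary_unique p q :
    \sum_x p x = 1 -> (forall y, \sum_x p x * M x y = p y) ->
    \sum_x q x = 1 -> (forall y, \sum_x q x * M x y = q y) ->
  p =1 q.
Proof.
move=> p1 pM q1 qM x.
have [u uE] := poisson_solution (fun y => (y == x)%:R).
have ev (r : I -> R) : \sum_y r y * (y == x)%:R = r x.
  by rewrite -[RHS](sum_delta r); apply: eq_bigr => y _; rewrite mulrC.
rewrite -[LHS]ev -[RHS]ev; under eq_bigr do rewrite -uE.
under [RHS]eq_bigr do rewrite -uE.
by rewrite !stationary_functional.
Qed.

(* The signed invariant vector given by invertibility is nonnegative: its
   absolute value is subinvariant with the same mass, hence invariant. *)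
Lemma stationary_exists :
  exists p : I -> R, [/\ forall x, 0 <= p x, \sum_x p x = 1 &
    forall y, \sum_x p x * M x y = p y].
Proof.
have [|_ /(_ (fun y => (y == x0)%:R))[p pA]] := @fin_linear_surj R I A.
  by move=> u uE; apply: atom_injective => x; rewrite -AE.
(* Since [A] fixes the constant 1, [p] has the same mass as [p A], the unit mass at [x0]. Once this
   mass is known to be 1, the rank-one term cancels the right-hand side and invariance remains. *)
have p1 : \sum_x p x = 1.
  have : \sum_y \sum_x p x * A x y = 1.
    under eq_bigr do rewrite pA -[_%:R]mulr1.
    by rewrite (sum_delta (fun=> 1)).
  rewrite exchange_big/= => <-; apply: eq_bigr => x _.
  rewrite -mulr_sumr; under eq_bigr do rewrite -[A _ _]mulr1.
  rewrite (AE (fun=> 1)); under eq_bigr do rewrite mulr1.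
  by rewrite M_sum subrr add0r mulr1.
have pM y : \sum_x p x * M x y = p y.
  have := pA y; under eq_bigr do rewrite /A mulrDr mulrBr eq_sym.
  rewrite big_split sumrB/= -mulr_suml p1 mul1r.
  rewrite [X in X - _ + _](_ : _ = p y); last first.
    by rewrite -[RHS](sum_delta p); apply: eq_bigr => x _; rewrite mulrC.
  by move/eqP; rewrite -subr_eq0 addrK subr_eq0 => /eqP ->.
pose s := \sum_x `|p x|.
have s_gt0 : 0 < s.
  by rewrite (lt_le_trans ltr01)// -p1 (le_trans (ler_norm _))// ler_norm_sum.
have absM y : \sum_x `|p x| * M x y = `|p y|.
  have ge0 z : true -> 0 <= \sum_x `|p x| * M x z - `|p z|.
    move=> _; rewrite subr_ge0 -pM (le_trans (ler_norm_sum _ _ _))//.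
    by apply: ler_sum => x _; rewrite normrM (ger0_norm (M_ge0 _ _)).
  have sum0 : \sum_z (\sum_x `|p x| * M x z - `|p z|) = 0.
    rewrite sumrB exchange_big/=; under eq_bigr do rewrite -mulr_sumr M_sum mulr1.
    by rewrite subrr.
  by apply/eqP; rewrite -subr_eq0; apply/eqP; exact: (psumr_eq0P ge0 sum0).
have pE : p =1 (fun x => s^-1 * `|p x|).
  apply: stationary_unique => //.
    by rewrite -mulr_sumr mulVf// gt_eqF.
  by move=> y; under eq_bigr do rewrite -mulrA; rewrite -mulr_sumr absM.
exists p; split => // x.
by rewrite pE mulr_ge0// invr_ge0 ltW.
Qed.

End Atom.
End MarkovChain.

(** * Means expressed through survival functions *)

Lemma nneseries_le (R : realType) (u : nat -> \bar R) (x : \bar R) :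
    (forall j, 0 <= u j)%E ->
    (forall N : nat, \sum_(0 <= j < N) u j <= x)%E ->
  (\sum_(0 <= j <oo) u j <= x)%E.
Proof.
by move=> u0 ux; apply: lime_le; [exact: is_cvg_nneseries|exact: nearW].
Qed.

(* Abel summation for the mean of a law on the positive integers with
   survival function S, with a possible atom at infinity. *)
Lemma nneseries_survival (R : realType) (S : nat -> R) :
    S 0%N = 1 -> (forall j, 0 <= S j) -> (forall j, S j.+1 <= S j) ->
  (\sum_(0 <= j <oo) (j.+1%:R * (S j - S j.+1))%:E
   + +oo * (1 - \sum_(0 <= j <oo) (S j - S j.+1)%:E)
   = \sum_(0 <= j <oo) (S j)%:E)%E.
Proof.
move=> S0 S_ge0 S_dec.
have S_homo : {homo S : m n / (m <= n)%N >-> n <= m}.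
  by apply/nonincreasing_seqP.
have cvS : S @ \oo --> limn S.
  by apply: nonincreasing_is_cvgn => //; exists 0 => _ [j _ <-].
have s_ge0 : 0 <= limn S by apply: limr_ge => //; exact: nearW.
have s_le j : limn S <= S j by exact: nonincreasing_cvgn_ge.
have fE : (\sum_(0 <= j <oo) (S j - S j.+1)%:E = (1 - limn S)%:E)%E.
  apply/cvg_lim => //; under eq_fun do rewrite sumEFin.
  apply: cvg_EFin; first exact: nearW.
  rewrite [X in X @ _ --> _](_ : _ = fun N => 1 - S N); first exact: cvgB (cvg_cst _) cvS.
  apply/funext => N /=; under eq_bigr do rewrite -opprB.
  by rewrite sumrN telescope_sumr// S0 opprB.
have mean_ge0 j : 0 <= j.+1%:R * (S j - S j.+1) by rewrite mulr_ge0// subr_ge0.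
have sumE N : \sum_(0 <= j < N) j.+1%:R * (S j - S j.+1) =
    \sum_(0 <= j < N) S j - N%:R * S N.
  elim: N => [|N IH]; first by rewrite !big_nil mul0r subrr.
  by rewrite !big_nat_recr//= IH -natr1; ring.
rewrite fE -EFinB [1 - (1 - _)](_ : _ = limn S); last by ring.
(* A positive limit of [S] is an atom at infinity. Both sides are then infinite, the right one
   because its partial sums dominate [N * limn S]. *)
have [s_gt0|s_le0] := ltP 0 (limn S).
  rewrite gt0_mulye ?lte_fin// addey; last first.
    by rewrite gt_eqF// (lt_le_trans ltNy0)// nneseries_ge0// => j _ _; rewrite lee_fin.
  apply/esym/eqyP => A A_gt0.
  pose N := (Num.trunc (A / limn S)).+1.
  apply: (@le_trans _ _ (\sum_(0 <= j < N) (S j)%:E)%E); last first.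
    by apply: nneseries_lim_ge => j _ _; rewrite lee_fin.
  rewrite sumEFin lee_fin (@le_trans _ _ (\sum_(0 <= j < N) limn S))//.
    rewrite sumr_const_nat subn0 -mulr_natl -ler_pdivrMr// ltW//.
    by rewrite truncnS_gt.
  by apply: ler_sum.
have s0 : limn S = 0 by apply/eqP; rewrite eq_le s_le0.
rewrite s0 mule0 adde0; apply/eqP; rewrite eq_le; apply/andP; split.
  apply: nneseries_le => [j|N]; first by rewrite lee_fin.
  apply: (@le_trans _ _ (\sum_(0 <= j < N) (S j)%:E)%E); last first.
    by apply: nneseries_lim_ge => j _ _; rewrite lee_fin.
  by rewrite !sumEFin lee_fin sumE gerBl mulr_ge0.
apply: nneseries_le => [j|N]; first by rewrite lee_fin.
(* The Abel identity up to [L], with each [S j] for [N <= j < L] bounded below by [S L], leaves the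
   correction [N * S L], which vanishes as [L] grows with [N] fixed. *)
have le_part L : (N <= L)%N ->
    ((\sum_(0 <= j < N) S j - N%:R * S L)%:E <=
     \sum_(0 <= j <oo) (j.+1%:R * (S j - S j.+1))%:E)%E.
  move=> NL; apply: (@le_trans _ _
      (\sum_(0 <= j < L) (j.+1%:R * (S j - S j.+1))%:E)%E); last first.
    by apply: nneseries_lim_ge => j _ _; rewrite lee_fin.
  rewrite sumEFin lee_fin sumE (big_cat_nat _ NL)//=.
  have : \sum_(N <= j < L) S L <= \sum_(N <= j < L) S j.
    by apply: ler_sum_nat => j /andP[_ /ltnW/S_homo].
  rewrite sumr_const_nat -[_ *+ (L - N)]mulr_natl natrB//; lra.
have := le_part; case: (X in (_ <= X)%E) => [x|_|/(_ N (leqnn N))//]; last exact: leey.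
move=> le_x; rewrite sumEFin lee_fin.
have : (fun L => \sum_(0 <= j < N) S j - N%:R * S L) @ \oo --> \sum_(0 <= j < N) S j.
  rewrite -[X in _ --> X]subr0 -[X in _ --> _ - X](mulr0 N%:R) -s0.
  by apply: cvgB; [exact: cvg_cst|exact: cvgMr].
move/cvgr_to_le; apply; near=> L.
by rewrite -lee_fin le_x//; near: L; exact: nbhs_infty_ge.
Unshelve. all: by end_near. Qed.

(** * Chains killed on entering the complement of a set *)

Section KilledChain.
Context (R : realType) (I : finType) (M : I -> I -> R) (D : pred I).
Hypothesis M_ge0 : forall x y, 0 <= M x y.
Hypothesis M_sum : forall x, \sum_y M x y = 1.
Implicit Types (u f : I -> R).

(** Only the state that is entered is tested against [D], so the starting point may lie outside [D]:
    a chain that has just been reset must still count as alive. *)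
Definition killed u : I -> R := fun x => \sum_(y | D y) M x y * u y.

Definition survival (j : nat) : I -> R := iter j killed (fun=> 1).

Lemma killed_le u v :
  (forall x, u x <= v x) -> forall x, killed u x <= killed v x.
Proof. by move=> uv x; apply: ler_sum => y _; rewrite ler_wpM2l. Qed.

Lemma killed1_le x : killed (fun=> 1) x <= 1.
Proof.
rewrite -[leRHS](M_sum x) [leRHS](bigID D)/= /killed/=.
under eq_bigr do rewrite mulr1.
by rewrite lerDl sumr_ge0.
Qed.

Lemma survival_ge0 j x : 0 <= survival j x.
Proof.
elim: j x => [|j IH] x; first exact: ler01.
by apply: sumr_ge0 => y _; rewrite mulr_ge0.
Qed.

Lemma survivalS_le j x : survival j.+1 x <= survival j x.
Proof.
elim: j x => [|j IH] x; first exact: killed1_le.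
exact: killed_le.
Qed.

Lemma survival_le1 j x : survival j x <= 1.
Proof. by elim: j => // j IH; exact: le_trans (survivalS_le j x) IH. Qed.

Lemma iter_killed_le u (c : R) j x :
  (forall x, `|u x| <= c) -> `|iter j killed u x| <= c * survival j x.
Proof.
move=> uc; elim: j x => [|j IH] x; first by rewrite mulr1.
rewrite /= (le_trans (ler_norm_sum _ _ _))// mulr_sumr.
by apply: ler_sum => y _; rewrite normrM ger0_norm// mulrCA ler_wpM2l.
Qed.

Lemma iter_killed_system f :
    (forall x, f x = 1 + killed f x) ->
  forall j x, iter j killed f x = survival j x + iter j.+1 killed f x.
Proof.
move=> fE; elim=> [|j IH] x; first exact: fE.
rewrite iterS [RHS]addrC -[_ + _]/(killed (iter j.+1 killed f) x + killed (survival j) x).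
rewrite /killed -big_split/=; apply: eq_bigr => y _.
by rewrite -mulrDr IH addrC.
Qed.

Lemma sum_survival f :
    (forall x, f x = 1 + killed f x) ->
  forall N x, \sum_(0 <= j < N) survival j x = f x - iter N killed f x.
Proof.
move=> fE N x; elim: N => [|N IH]; first by rewrite big_nil subrr.
by rewrite big_nat_recr//= IH (iter_killed_system fE N) /=; ring.
Qed.

(** A function fixed by [killed] is fixed by its [N]-th iterate, which shrinks the maximal modulus
    strictly, so it is zero. Hence I - [killed] is injective and, in finite dimension, onto. *)
Lemma killed_system_solution N :
    (forall x, survival N x < 1) ->
  exists f, forall x, f x = 1 + killed f x.
Proof.
move=> SN; pose A x y := (y == x)%:R - (D y)%:R * M x y.
have AE u x : \sum_y A x y * u y = u x - killed u x.
  under eq_bigr do rewrite mulrBl; rewrite sumrB; congr (_ - _).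
    rewrite (bigD1 x)//= eqxx mul1r big1 ?addr0// => y /negbTE ->.
    by rewrite mul0r.
  rewrite /killed [RHS]big_mkcond/=; apply: eq_bigr => y _.
  by case: (D y); rewrite ?mul1r ?mul0r.
have [|+ _] := @fin_linear_surj R I A; last first.
  move=> /(_ (fun=> 1))[f fE]; exists f => x; move: (fE x); rewrite AE.
  by move=> <-; rewrite subrK.
move=> u uE x0; have kE x : killed u x = u x.
  by apply/eqP; rewrite eq_sym -subr_eq0 -AE uE.
have iterE j x : iter j killed u x = u x.
  elim: j x => // j IH x; rewrite iterS -[RHS]kE.
  by apply: eq_bigr => y _; rewrite IH.
have [x _ xmax] := arg_maxP (fun y => `|u y|) (erefl true : xpredT x0).
have : `|u x| <= `|u x| * survival N x.
  by rewrite -{1}(iterE N x); apply: iter_killed_le => y; exact: xmax.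
move=> le_S; have ux0 : `|u x| <= 0.
  by move: (normr_ge0 (u x)) (SN x) le_S; nra.
by apply/eqP; rewrite -normr_le0; apply: le_trans ux0; exact: xmax.
Qed.

(** The term [j = 0] of the series is 1, and the rest is one killed step applied termwise. All terms
    are nonnegative, so the sums may be exchanged even when they are infinite. *)
Lemma survival_system (F := fun x => (\sum_(0 <= j <oo) (survival j x)%:E)%E) x :
  (F x = 1 + \sum_(y | D y) (M x y)%:E * F y)%E.
Proof.
rewrite /F nneseries_recl//; last by move=> j _; rewrite lee_fin survival_ge0.
congr (_ + _)%E; rewrite -nneseries_addn; last first.
  by move=> j; rewrite lee_fin survival_ge0.
under eq_eseriesr do rewrite addn1.
rewrite [LHS](_ : _ = \sum_(0 <= j <oo)
    \sum_(y | D y) (M x y)%:E * (survival j y)%:E)%E; last first.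
  by apply: eq_eseriesr => j _; rewrite -sumEFin.
rewrite nneseries_sum; last first.
  by move=> y j _; rewrite mule_ge0// lee_fin ?survival_ge0.
apply: eq_bigr => y _; rewrite nneseriesZl// => j _.
by rewrite lee_fin survival_ge0.
Qed.

(** Iterating the system leaves the remainder [iter N killed f], at most [c * survival N]. The
    partial sums are therefore bounded, so [survival N] tends to 0 and the remainder with it. *)
Lemma survival_system_unique f :
    (forall x, f x = 1 + killed f x) ->
  forall x, (\sum_(0 <= j <oo) (survival j x)%:E = (f x)%:E)%E.
Proof.
move=> fE x; pose c := \sum_y `|f y|.
have fc y : `|f y| <= c by rewrite /c (bigD1 y)//= lerDl sumr_ge0.
have c0 : 0 <= c by exact: le_trans (fc x).
have rem N : `|iter N killed f x| <= c * survival N x by exact: iter_killed_le.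
have cvs : cvgn (series (fun j => survival j x)).
  apply: nondecreasing_is_cvgn.
    by apply/nondecreasing_seqP => N; rewrite /series/= big_nat_recr//= lerDl survival_ge0.
  exists (f x + c) => _ [N _ <-]; rewrite /series/= (sum_survival fE).
  rewrite lerD2l lerNl; have := rem N; rewrite ler_norml => /andP[+ _].
  by apply: le_trans; rewrite lerN2 ler_piMr// survival_le1.
have S0 : (fun j => c * survival j x) @ \oo --> 0.
  by rewrite -[X in _ --> X](mulr0 c); apply: cvgMr; exact: cvg_series_cvg_0.
have r0 : (fun N => iter N killed f x) @ \oo --> 0.
  apply/norm_cvg0P; apply: (squeeze_cvgr _ (cvg_cst 0) S0).
  by apply: nearW => N; rewrite /= normr_ge0 rem.
apply/cvg_lim => //; under eq_fun do rewrite sumEFin.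
apply: cvg_EFin; first exact: nearW.
rewrite [X in X @ _ --> _](_ : _ = fun N => f x - iter N killed f x).
  by rewrite -[X in _ --> X]subr0; apply: cvgB => //; exact: cvg_cst.
by apply/funext => N /=; rewrite (sum_survival fE).
Qed.

End KilledChain.

(** * Limits of time averages *)

Lemma cvg_mean_telescope (R : realType) (a G : nat -> R) (l c : R) :
    (forall t, a t = l + G t - G t.+1) -> (forall t, `|G t| <= c) ->
  (fun N : nat => N%:R^-1 * \sum_(1 <= t < N.+1) a t) @ \oo --> l.
Proof.
(* The shift makes the averaging factor the inverse of a nonzero number. *)
move=> aE Gc; rewrite -cvg_shiftS.
have sumE N : \sum_(1 <= t < N.+1) a t = N%:R * l + (G 1%N - G N.+1).
  elim: N => [|N IH]; first by rewrite big_nil mul0r subrr addr0.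
  by rewrite big_nat_recr//= IH aE -natr1; ring.
rewrite [X in X @ _ --> _](_ : _ = fun N : nat =>
    l + N.+1%:R^-1 * (G 1%N - G N.+2)); last first.
  by apply/funext => N /=; rewrite sumE mulrDr mulrA mulVf ?mul1r// pnatr_eq0.
rewrite -[in X in _ --> X](addr0 l); apply: cvgD; first exact: cvg_cst.
have h0 : (fun N : nat => N.+1%:R^-1 * (c + c)) @ \oo --> (0 : R).
  by rewrite -[in X in _ --> X](mul0r (c + c)); apply: cvgMl; exact: cvg_harmonic.
apply/norm_cvg0P; apply: (squeeze_cvgr _ (cvg_cst 0) h0).
apply: nearW => N; rewrite /= normr_ge0 normrM ger0_norm ?invr_ge0//=.
by rewrite ler_wpM2l ?invr_ge0// (le_trans (ler_normB _ _))// lerD.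
Qed.

Lemma cvg_mean_pinfty (R : realType) (a : nat -> R) :
    (forall t, a t = t.+1%:R) ->
  (fun N : nat => (N%:R^-1 * \sum_(1 <= t < N.+1) a t)%:E) @ \oo --> (+oo%E : \bar R).
Proof.
move=> aE.
have sumE N : \sum_(1 <= t < N.+1) a t = N%:R * ((N%:R + 3) / 2).
  elim: N => [|N IH]; first by rewrite big_nil mul0r.
  by rewrite big_nat_recr//= IH aE -!natr1; field.
apply/cvgeyPge => A; near=> N.
rewrite lee_fin sumE mulrA mulVf ?mul1r; last first.
  by rewrite pnatr_eq0 -lt0n; near: N; exact: nbhs_infty_gt.
have : 2 * `|A| <= N%:R by near: N; exact: nbhs_infty_ger.
by have := ler_norm A; lra.
Unshelve. all: by end_near. Qed.

(** * Long-run average of the mean age *)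

Section AverageCost.
Context (R : realType) (I : finType) (M : I -> I -> R) (D : pred I).
Hypothesis M_ge0 : forall x y, 0 <= M x y.
Hypothesis M_sum : forall x, \sum_y M x y = 1.
Variables (up : I -> I) (K : nat) (x0 : I).
Hypothesis M_up : forall x, 0 < M x (up x).
Hypothesis iter_up : forall x, iter K up x = x0.
Variable mu : nat -> I -> R.
Hypothesis mu_ge0 : forall t x, 0 <= mu t x.
Hypothesis mu_sum : forall t, \sum_x mu t x = 1.
Hypothesis muS : forall t y, mu t.+1 y = \sum_x mu t x * M x y.

(** The tail sum of P(g(t) > j): an age exceeds [j] when the last [j] steps, started from the law at
    time [t - j], contain no reset. The index stops at [t] since the age is at most [t + 1]. *)
Definition mean_age (t : nat) : R :=
  \sum_(j < t.+1) \sum_x mu (t - j)%N x * survival M D j x.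

Let pair t (u : I -> R) := \sum_x mu t x * u x.

Let pairS t u : pair t.+1 u = pair t (fun x => \sum_y M x y * u y).
Proof.
rewrite /pair; under eq_bigr do rewrite muS mulr_suml.
rewrite exchange_big/=; apply: eq_bigr => x _; rewrite mulr_sumr.
by apply: eq_bigr => y _; rewrite mulrA.
Qed.

Let pair_cst t c : pair t (fun=> c) = c.
Proof. by rewrite /pair -mulr_suml mu_sum mul1r. Qed.

Let pair_le t u v : (forall x, u x <= v x) -> pair t u <= pair t v.
Proof. by move=> uv; apply: ler_sum => x _; rewrite ler_wpM2l. Qed.

(* With [H t] the sum over j of the mass of [mu (t - j)] against the j-th killed
   iterate of f, [f = 1 + killed f] turns mean_age into a telescoping
   difference plus [pair t.+1 f], and a solution of Poisson's equation
   telescopes the latter. *)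
Lemma mean_age_average (f p : I -> R) :
    (forall x, 0 <= f x) -> (forall x, f x = 1 + killed M D f x) ->
    \sum_x p x = 1 -> (forall y, \sum_x p x * M x y = p y) ->
  (fun N : nat => N%:R^-1 * \sum_(1 <= t < N.+1) mean_age t) @ \oo -->
    \sum_x p x * f x.
Proof.
move=> f0 fE p1 pM.
have [u uE] := poisson_solution M_ge0 M_sum M_up iter_up f.
have lE : \sum_x p x * f x = u x0.
  by rewrite -(stationary_functional x0 u p1 pM); apply: eq_bigr => x _; rewrite uE.
(* The summand 1 ensures [c >= 1], which is used in the bound on [H]. *)
pose c := 1 + \sum_x f x.
have fc x : `|f x| <= c.
  rewrite ger0_norm// /c (bigD1 x)//= addrCA lerDl addr_ge0//.
  exact: sumr_ge0.
have c1 : 1 <= c by rewrite lerDl sumr_ge0.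
pose H t := \sum_(j < t.+1) pair (t - j) (iter j (killed M D) f).
have HS t : H t.+1 = pair t.+1 f + H t - mean_age t.
  rewrite /H big_ord_recl/= subn0 -addrA; congr (_ + _).
  rewrite -sumrB; apply: eq_bigr => j _; rewrite subSS -sumrB.
  apply: eq_bigr => x _; rewrite -mulrBr; congr (_ * _).
  by rewrite (iter_killed_system fE) addrC addKr.
have k0 j x : 0 <= iter j (killed M D) f x.
  elim: j x => [|j IH] x; first exact: f0.
  by apply: sumr_ge0 => y _; apply: mulr_ge0; [exact: M_ge0|exact: IH].
have H0 t : 0 <= H t.
  by apply: sumr_ge0 => j _; apply: sumr_ge0 => x _; apply: mulr_ge0; [exact: mu_ge0|exact: k0].
have Hage t : H t <= c * mean_age t.
  rewrite /mean_age mulr_sumr; apply: ler_sum => j _; rewrite mulr_sumr.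
  apply: ler_sum => x _; rewrite mulrCA ler_wpM2l//.
  by apply: le_trans (ler_norm _) _; exact: iter_killed_le.
have fpair t : pair t f <= c.
  by rewrite -[leRHS](pair_cst t); apply: pair_le => x; exact: le_trans (ler_norm _) (fc x).
(* As [H t <= c * mean_age t], the recursion [HS] gives [H t.+1 <= c + (1 - 1/c) * H t], and this
   preserves the bound [c * c]. *)
have Hc t : H t <= c * c.
  elim: t => [|t IH].
    by rewrite /H big_ord1/= (le_trans (fpair _))// ler_peMr// (le_trans ler01).
  have c_gt0 : 0 < c by exact: lt_le_trans ltr01 c1.
  rewrite HS -(ler_pM2l c_gt0).
  have h1 : 0 <= (c - 1) * (c * c - H t) by rewrite mulr_ge0 ?subr_ge0.
  have h2 : 0 <= c * (c - pair t.+1 f) by rewrite mulr_ge0 ?subr_ge0// ltW.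
  move: h1 h2 (Hage t); generalize (pair t.+1 f) (H t) (mean_age t) => x y w.
  by lra.
pose d := \sum_x `|u x|.
have uc t : `|pair t u| <= d.
  rewrite (le_trans (ler_norm_sum _ _ _))//; apply: ler_sum => x _.
  rewrite normrM ger0_norm// ler_piMl// -(mu_sum t) (bigD1 x)//= lerDl.
  exact: sumr_ge0.
(* The term in [u] is taken at time [t.+1] because [HS] expresses [mean_age t] through
   [pair t.+1 f]. *)
rewrite lE; apply: (@cvg_mean_telescope _ _ (fun t => H t + pair t.+1 u) _ (c * c + d)).
  move=> t; have -> : mean_age t = pair t.+1 f + H t - H t.+1 by rewrite HS; ring.
  suff -> : pair t.+1 f = pair t.+1 u - pair t.+2 u + u x0 by ring.
  rewrite [pair t.+2 _]pairS -[u x0 in RHS](pair_cst t.+1) /pair -sumrB -big_split/=.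
  by apply: eq_bigr => x _; rewrite -uE; ring.
move=> t; rewrite (le_trans (ler_normD _ _))// lerD//.
by rewrite ger0_norm.
Qed.

Lemma mean_age_survival1 :
  (forall j x, survival M D j x = 1) -> forall t, mean_age t = t.+1%:R.
Proof.
move=> S1 t; rewrite /mean_age.
under eq_bigr do under eq_bigr do rewrite S1 mulr1.
under eq_bigr do rewrite mu_sum.
by rewrite sumr_const card_ord.
Qed.

End AverageCost.

(** * The chain of truncated ages *)

Lemma ord2P (k : 'I_2) : k = idx1 \/ k = idx2.
Proof. by case: k => -[|[|//]] ki; [left|right]; apply: val_inj. Qed.

Definition sel (A : Type) (a : A * A) (k : 'I_2) : A := if k == idx1 then a.1 else a.2.

Lemma sum_bool2 (V : nmodType) (F : bool * bool -> V) :
  \sum_a F a = F (true, true) + F (true, false) + F (false, true) + F (false, false).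
Proof.
rewrite (eq_bigr (fun a => F (a.1, a.2))); last by case.
rewrite -(pair_bigA _ (fun x y => F (x, y)))/= big_bool/= !big_bool/=.
by rewrite !addrA.
Qed.

Section TruncatedStates.
Context (z : nat).
Hypothesis hz : (2 <= z)%N.
Implicit Types (phi : state z) (k : 'I_2) (a : bool * bool).

(** The flags [a] mark the components that are reset. States store levels less one, hence the values
    0 and [z.-1]; both alternatives lie in range, so the default of [insubd] never occurs. *)
Definition next phi a : state z :=
  [ffun k => insubd (phi k) (if sel a k then 0%N else minn (phi k).+1 z.-1)].

Lemma level_next phi a k :
  level (next phi a) k = if sel a k then 1%N else minn (level phi k).+1 z.
Proof.
have z_gt0 : (0 < z)%N by exact: ltnW.
rewrite /level ffunE val_insubd; case: (sel a k); first by rewrite z_gt0.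
have -> : (minn (phi k).+1 z.-1 < z)%N by lia.
by lia.
Qed.

Lemma level_le phi k : (level phi k <= z)%N. Proof. exact: ltn_ord. Qed.

Lemma level_inj phi phi' : (forall k, level phi k = level phi' k) -> phi = phi'.
Proof. by move=> e; apply/ffunP => k; apply: val_inj; case: (e k). Qed.

(** As [z >= 2], a component that is not reset moves to level 2 or higher; resets can thus be read
    off the target state. *)
Lemma level_next_eq1 phi a k : (level (next phi a) k == 1%N) = sel a k.
Proof.
rewrite level_next; case: (sel a k) => //.
by apply/negbTE; rewrite gtn_eqF// leq_min hz andbT ltnS.
Qed.

Lemma next_eqE phi phi' a : (phi' == next phi a) =
  (level phi' idx1 == level (next phi a) idx1) &&
  (level phi' idx2 == level (next phi a) idx2).
Proof.
apply/eqP/andP => [->//|[/eqP e1 /eqP e2]].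
by apply: level_inj => k; case: (ord2P k) => ->.
Qed.

Definition up phi : state z := next phi (false, false).

Lemma level_iter_up phi k j : level (iter j up phi) k = minn (level phi k + j) z.
Proof.
elim: j => [|j IH]; first by rewrite addn0 (minn_idPl (level_le _ _)).
rewrite iterS level_next /sel if_same IH addnS -[(minn _ _).+1]minnSS -minnA.
by rewrite (minn_idPr (leqnSn z)).
Qed.

Definition top : state z := iter z up [ffun=> insubd (Ordinal hz) 0%N].

Lemma level_top k : level top k = z.
Proof.
by rewrite level_iter_up; apply/minn_idPr; rewrite leq_addl.
Qed.

Lemma iter_up phi : iter z up phi = top.
Proof.
apply: level_inj => k; rewrite level_top level_iter_up.
by apply/minn_idPr; rewrite leq_addl.
Qed.

End TruncatedStates.

(** * The transition matrix as two independent resets *)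

Section TruncatedChain.
Context (R : realType) (z : nat) (b : 'I_2 -> 'I_2 -> R) (r1 r2 : R).
Context (tie : tie_rule) (n : 'I_2).
Hypothesis hb : forall n k, 0 <= b n k <= 1.
Hypothesis hr1 : 0 <= r1 <= 1.
Hypothesis hr2 : 0 <= r2 <= 1.
Hypothesis hz : (2 <= z)%N.
Implicit Types (phi : state z) (k : 'I_2) (a : bool * bool).

Local Notation M := (@Pc R z b r1 r2 tie n).

Definition reset_prob phi k : R :=
  sel (class_probs tie r1 r2 phi) k * xi b n k.

Definition reset_weight phi a : R :=
  bernoulli_weight (reset_prob phi idx1) a.1 *
  bernoulli_weight (reset_prob phi idx2) a.2.

(** Each [q] in the table is [1 - p * xi], so the four entries are products of two Bernoulli
    weights. Splitting on which components of [phi'] equal 1 leaves at most one possible target,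
    since [z >= 2] keeps the four targets distinct. *)
Lemma PcE phi phi' :
  M phi phi' = \sum_a reset_weight phi a * (phi' == next phi a)%:R.
Proof.
rewrite sum_bool2 !next_eqE !(level_next hz) /sel/= /Pc /reset_weight /reset_prob /sel/=.
case: (class_probs tie r1 r2 phi) => p1 p2.
have n1 k : (1%N == minn (level phi k).+1 z) = false.
  by apply/negbTE; rewrite ltn_eqF// leq_min hz andbT ltnS.
case: (level phi' idx1 =P 1%N) => [->|_]; rewrite ?n1/=;
  case: (level phi' idx2 =P 1%N) => [->|_]; rewrite ?n1/= ?andbF/=.
- by rewrite !mulr0 !addr0; ring.
- case: ifP => _; rewrite !(mulr0, mulr1, addr0, add0r)//.
  by ring.
- rewrite !andbT; case: ifP => _; rewrite !(mulr0, mulr1, addr0, add0r)//.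
  by ring.
- case: ifP => _; rewrite !(mulr0, mulr1, addr0, add0r)//.
  by ring.
Qed.

Lemma sum_Pc phi (G : state z -> R) :
  \sum_phi' M phi phi' * G phi' = \sum_a reset_weight phi a * G (next phi a).
Proof.
under eq_bigr do rewrite PcE mulr_suml.
rewrite exchange_big/=; apply: eq_bigr => a _.
rewrite (bigD1 (next phi a))//= eqxx mulr1 big1 ?addr0// => phi' /negbTE ->.
by rewrite mulr0 mul0r.
Qed.

Lemma class_probs_bound phi k : 0 <= sel (class_probs tie r1 r2 phi) k <= 1.
Proof.
move: hr1 hr2 => /andP[? ?] /andP[? ?]; rewrite /sel /class_probs.
by case: (k == idx1); do 3 ?[case: ifP => _] => /=; lra.
Qed.

Lemma reset_prob_bound phi k : 0 <= reset_prob phi k <= 1 / 2.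
Proof.
have := class_probs_bound phi k; rewrite /reset_prob /xi.
move: (sel _ k) => p /andP[p0 p1]; have /andP[b0 b1] := hb n k.
have x0 : 0 <= 2 * (b n k * (1 - b n k)) by rewrite !mulr_ge0// subr_ge0.
have x1 : 2 * (b n k * (1 - b n k)) <= 1 / 2.
  by have := sqr_ge0 (2 * b n k - 1); lra.
by rewrite mulr_ge0//= (le_trans _ x1)// ler_piMl.
Qed.

Lemma bernoulli_reset_ge0 phi k c : 0 <= bernoulli_weight (reset_prob phi k) c.
Proof.
by have := reset_prob_bound phi k; case: c => /=; lra.
Qed.

Lemma reset_weight_ge0 phi a : 0 <= reset_weight phi a.
Proof. by rewrite mulr_ge0// bernoulli_reset_ge0. Qed.

Lemma sum_reset_weight phi : \sum_a reset_weight phi a = 1.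
Proof. by rewrite sum_bool2 /reset_weight/=; ring. Qed.

Lemma Pc_ge0 phi phi' : 0 <= M phi phi'.
Proof. by rewrite PcE sumr_ge0// => a _; rewrite mulr_ge0// reset_weight_ge0. Qed.

Lemma Pc_sum1 phi : \sum_phi' M phi phi' = 1.
Proof.
under eq_bigr do rewrite -[M _ _]mulr1.
rewrite (sum_Pc phi (fun=> 1)); under eq_bigr do rewrite mulr1.
exact: sum_reset_weight.
Qed.

Lemma reset_weight_up_gt0 phi : 0 < reset_weight phi (false, false).
Proof.
have /andP[_ h1] := reset_prob_bound phi idx1.
have /andP[_ h2] := reset_prob_bound phi idx2.
by rewrite mulr_gt0//= subr_gt0; lra.
Qed.

Lemma Pc_up phi : 0 < M phi (up phi).
Proof.
rewrite PcE (bigD1 (false, false))//= eqxx mulr1 ltr_pwDl//.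
  exact: reset_weight_up_gt0.
by rewrite sumr_ge0// => a _; rewrite mulr_ge0// reset_weight_ge0.
Qed.

Variable k : 'I_2.
Let D : pred (state z) := fun phi => level phi k != 1%N.

Lemma killed_Pc u phi : killed M D u phi =
  \sum_a reset_weight phi a * (if sel a k then 0 else u (next phi a)).
Proof.
transitivity (\sum_phi' M phi phi' * (if D phi' then u phi' else 0)).
  rewrite /killed [LHS]big_mkcond; apply: eq_bigr => phi' _.
  by case: ifP; rewrite ?mulr0.
rewrite sum_Pc; apply: eq_bigr => a _; rewrite /D (level_next_eq1 hz).
by case: (sel a k).
Qed.

Lemma weighted_lt1 phi (g : bool * bool -> R) a :
    (forall a', g a' <= 1) -> 0 < reset_weight phi a -> g a < 1 ->
  \sum_a' reset_weight phi a' * g a' < 1.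
Proof.
move=> g1 wa ga; rewrite -subr_gt0 -(sum_reset_weight phi) -sumrB.
under eq_bigr => a' _ do rewrite -{1}[reset_weight _ _]mulr1 -mulrBr.
rewrite (bigD1 a)//= ltr_pwDl//; first by apply: mulr_gt0; rewrite ?subr_gt0.
by apply: sumr_ge0 => a' _; rewrite mulr_ge0 ?subr_ge0 ?reset_weight_ge0.
Qed.

(** With positive probability the chain climbs for [z] steps to (z, z), where both command
    probabilities are r/2 > 0, and then resets component [k]. *)
Lemma survival_lt1 : 0 < b n k < 1 -> 0 < r1 + r2 ->
  forall phi, survival M D z.+1 phi < 1.
Proof.
move=> /andP[bk0 bk1] r_gt0 phi.
have xi_gt0 : 0 < xi b n k by rewrite !mulr_gt0// subr_gt0.
have gle1 j psi a : (if sel a k then 0 else survival M D j (next psi a)) <= 1.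
  by case: ifP => _; [exact: ler01|exact: (survival_le1 _ Pc_ge0 Pc_sum1)].
(* Here [j] bounds the number of upward steps still needed to reach (z, z). *)
suff claim j psi : (forall k', z <= level psi k' + j)%N -> survival M D j.+1 psi < 1.
  by apply: claim => k'; exact: leq_addl.
elim: j psi => [|j IH] psi lev; rewrite /survival iterS killed_Pc.
- have lev_z k' : level psi k' = z.
    by apply/eqP; rewrite eqn_leq level_le/= -[level _ _]addn0.
  have hp k' : sel (class_probs tie r1 r2 psi) k' = (r1 + r2) / 2.
    by rewrite /class_probs /= !lev_z ltnn andbF /sel if_same.
  have hk : 0 < reset_prob psi k by rewrite /reset_prob hp mulr_gt0// divr_gt0.
  (* These flags reset component [k] and no other. *)
  apply: (@weighted_lt1 _ _ (k == idx1, k != idx1)).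
  + by move=> a; exact: (gle1 0%N).
  + have /andP[_ h1] := reset_prob_bound psi idx1.
    have /andP[_ h2] := reset_prob_bound psi idx2.
    rewrite /reset_weight; move: hk.
    by case: (ord2P k) => -> hk /=; rewrite mulr_gt0//= subr_gt0; lra.
  + by rewrite /sel /=; case: eqP.
- apply: (@weighted_lt1 _ _ (false, false)); first by move=> a; exact: (gle1 j.+1).
    exact: reset_weight_up_gt0.
  rewrite /sel if_same; apply: IH => k'; rewrite (level_next hz) /sel if_same.
  by have := lev k'; rewrite /=; lia.
Qed.

(** Either [b n k] is 0 or 1, so that [xi] vanishes, or [r1 = r2 = 0], so that every command
    probability does. A reset of [k] then has probability 0 in every state. *)
Lemma survival_eq1 : ~~ ((0 < b n k < 1) && (0 < r1 + r2)) ->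
  forall j phi, survival M D j phi = 1.
Proof.
move=> deg; have rp0 psi : reset_prob psi k = 0.
  have /andP[b0 b1] := hb n k.
  rewrite /reset_prob /xi; move: deg; rewrite !negb_and -!leNgt => /orP[/orP[]|] h.
  - have -> : b n k = 0 by apply/eqP; rewrite eq_le h.
    by rewrite mul0r !mulr0.
  - have -> : b n k = 1 by apply/eqP; rewrite eq_le h b1.
    by rewrite subrr !mulr0.
  - have r10 : r1 = 0 by move: hr1 hr2 h; lra.
    have r20 : r2 = 0 by move: hr1 hr2 h; lra.
    rewrite /class_probs r10 r20 addr0 mul0r.
    by rewrite /sel; case: (k == idx1); do 3 ?[case: ifP => _]; rewrite /= mul0r.
elim=> // j IH phi; rewrite /survival iterS killed_Pc.
transitivity (\sum_a reset_weight phi a); last exact: sum_reset_weight.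
apply: eq_bigr => a _; rewrite -/(survival M D j) IH.
case: ifP; rewrite ?mulr1// mulr0 /reset_weight.
move: (rp0 phi); rewrite /sel; case: (ord2P k) => -> -> /= ->.
  by rewrite mul0r.
by rewrite mulr0.
Qed.

Lemma first_resetE j phi :
  first_reset M k j phi = survival M D j phi - survival M D j.+1 phi.
Proof.
elim: j phi => [|j IH] phi /=.
  have -> : killed M D (fun=> 1) phi = \sum_(phi' | D phi') M phi phi'.
    by apply: eq_bigr => phi' _; rewrite mulr1.
  rewrite -[X in X - _](Pc_sum1 phi) [X in X - _](bigID D)/= [RHS]addrC addKr.
  by apply: eq_bigl => phi'; rewrite /D negbK.
under eq_bigr do rewrite IH mulrBr.
by rewrite sumrB.
Qed.

Lemma expected_resetE phi :
  (expected_reset M k phi = \sum_(0 <= j <oo) (survival M D j phi)%:E)%E.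
Proof.
rewrite -(@nneseries_survival _ (fun j => survival M D j phi))//.
- rewrite /expected_reset; congr (_ + _ * (_ - _))%E;
    by apply: eq_eseriesr => j _; rewrite first_resetE.
- by move=> j; exact: survival_ge0 Pc_ge0 _ _.
- by move=> j; exact: (survivalS_le _ Pc_ge0 Pc_sum1).
Qed.

Lemma expected_reset_system : reset_system M k (expected_reset M k).
Proof.
move=> phi; rewrite expected_resetE (survival_system _ Pc_ge0).
by congr (_ + _)%E; apply: eq_bigr => phi' _; rewrite expected_resetE.
Qed.

Lemma reset_system_killed (f : state z -> R) :
  reset_system M k (fun phi => (f phi)%:E) <->
  forall phi, f phi = 1 + killed M D f phi.
Proof.
have rhsE phi : (1 + \sum_(phi' | level phi' k != 1%N) (M phi phi')%:E * (f phi')%:E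
    = (1 + killed M D f phi)%:E)%E.
  by rewrite EFinD /killed -sumEFin; under eq_bigr do rewrite -EFinM.
by split=> h phi; have := h phi; rewrite rhsE; [case|move->].
Qed.

Lemma expected_reset_unique (f : state z -> R) :
    reset_system M k (fun phi => (f phi)%:E) ->
  forall phi, expected_reset M k phi = (f phi)%:E.
Proof.
move=> /reset_system_killed fE phi; rewrite expected_resetE.
exact: (survival_system_unique Pc_ge0 Pc_sum1 fE).
Qed.

Lemma expected_reset_ge0 phi : (0 <= expected_reset M k phi)%E.
Proof.
by rewrite expected_resetE nneseries_ge0// => j _ _; rewrite lee_fin survival_ge0//; exact: Pc_ge0.
Qed.

(** The linear system has a real solution because survival drops below 1, and uniqueness identifies
    it with the expected reset time, from which it inherits nonnegativity. *)
Lemma expected_reset_finite : 0 < b n k < 1 -> 0 < r1 + r2 ->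
  exists f : state z -> R, [/\ forall phi, expected_reset M k phi = (f phi)%:E,
    forall phi, 0 <= f phi & forall phi, f phi = 1 + killed M D f phi].
Proof.
move=> hbk hr; have [f fE] := killed_system_solution Pc_ge0 (survival_lt1 hbk hr).
have FE := expected_reset_unique (iffRL (reset_system_killed f) fE).
exists f; split=> // phi.
by rewrite -lee_fin -FE expected_reset_ge0.
Qed.

Lemma expected_reset_pinfty : ~~ ((0 < b n k < 1) && (0 < r1 + r2)) ->
  forall phi, expected_reset M k phi = +oo%E.
Proof.
move=> /survival_eq1 S1 phi; rewrite expected_resetE; apply/eqyP => A A0.
pose N := (Num.trunc A).+1.
apply: (@le_trans _ _ (\sum_(0 <= j < N) (survival M D j phi)%:E)%E); last first.
  by apply: nneseries_lim_ge => j _ _; rewrite S1 lee_fin.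
rewrite sumEFin lee_fin; under eq_bigr do rewrite S1.
by rewrite sumr_const_nat subn0 ltW// truncnS_gt.
Qed.

End TruncatedChain.

(** * Laws of the network *)

Lemma big_ord2 (A : Type) (idx : A) (op : Monoid.law idx) (F : 'I_2 -> A) :
  \big[op/idx]_(i < 2) F i = op (F idx1) (F idx2).
Proof.
rewrite big_ord_recr big_ord1.
by congr (op (F _) (F _)); apply: val_inj.
Qed.

Lemma sel_pair (A : Type) (g : 'I_2 -> A) k : sel (g idx1, g idx2) k = g k.
Proof. by case: (ord2P k) => ->. Qed.

(** Truncation at [z] alters a comparison of ages only when both are at least [z], and there the
    policy uses r/2 for both CPs. The truncated state therefore determines the command
    probabilities. *)
Lemma command_probE (R : realType) (z : nat) (r1 r2 : R) (tie : tie_rule)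
    (phi : state z) (g : 'I_2 -> nat) k :
    (forall k, minn (g k) z = level phi k) ->
  command_prob tie r1 r2 z (g idx1) (g idx2) k = sel (class_probs tie r1 r2 phi) k.
Proof.
move=> gE; rewrite /command_prob /class_probs -(gE idx1) -(gE idx2).
move: (g idx1) (g idx2) => g1 g2; rewrite /sel.
case: (k == idx1); case: tie => /=; do 6?[case: ifP => /=] => *;
  first [ring | exfalso; lia].
Qed.

(** * Real-valued probabilities and finite partitions *)

Section Probability.
Context (d : measure_display) (T : measurableType d) (R : realType).
Context (P : probability T R).

Definition pr (A : set T) : R := fine (P A).

Lemma prE (A : set T) : measurable A -> P A = (pr A)%:E.
Proof. by move=> mA; rewrite fineK// fin_num_measure. Qed.

Lemma pr_ge0 (A : set T) : 0 <= pr A.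
Proof. exact: fine_ge0. Qed.

Lemma pr0 : pr set0 = 0.
Proof. by rewrite /pr measure0. Qed.

Lemma pr_setT : pr setT = 1.
Proof. by rewrite /pr probability_setT. Qed.

Lemma pr_partition (I : finType) (f : T -> I) (A : set T) :
    (forall i, measurable [set w | f w = i]) -> measurable A ->
  pr A = \sum_i pr (A `&` [set w | f w = i]).
Proof.
move=> mf mA.
have mem (s : seq I) : uniq s ->
    pr (A `&` [set w | f w \in s]) =
    \sum_(i <- s) pr (A `&` [set w | f w = i]).
  elim: s => [|i s IH] /=.
    by move=> _; rewrite big_nil -pr0; congr pr; apply/seteqP; split=> // w [].
  have ms : measurable (A `&` [set w | f w \in s]).
    elim: s {IH} => [|j s IH].
      by rewrite [X in measurable X](_ : _ = set0)//; apply/seteqP; split=> // w [].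
    rewrite [X in measurable X](_ : _ = (A `&` [set w | f w = j]) `|`
      (A `&` [set w | f w \in s])).
      by apply: measurableU => //; exact: measurableI.
    apply/seteqP; split=> w /=; rewrite inE.
      by move=> [Aw /orP[/eqP|]]; [left|right].
    by move=> [[Aw ->]|[Aw ->]]; rewrite ?eqxx ?orbT.
  move=> /andP[ni us]; rewrite big_cons -IH//.
  rewrite [X in pr X](_ : _ = (A `&` [set w | f w = i]) `|`
      (A `&` [set w | f w \in s])); last first.
    apply/seteqP; split=> w /=; rewrite inE.
      by move=> [Aw /orP[/eqP|]]; [left|right].
    by move=> [[Aw ->]|[Aw ->]]; rewrite ?eqxx ?orbT.
  have mi : measurable (A `&` [set w | f w = i]) by exact: measurableI.
  rewrite {1}/pr measureU//.
    by rewrite fineD ?fin_num_measure.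
  apply/seteqP; split=> // w [[_ /= fi] [_ /=]].
  by rewrite fi (negbTE ni).
have TE : A `&` [set w | f w \in enum I] = A.
  by apply/seteqP; split=> w /=; rewrite mem_enum; [case|split].
by rewrite -{1}TE mem ?enum_uniq// big_enum.
Qed.

Lemma forall_measurable (I : finType) (Q : I -> set T) :
  (forall i, measurable (Q i)) -> measurable [set w | forall i, Q i w].
Proof.
move=> mQ; rewrite [X in measurable X](_ : _ = \bigcap_(i in [set: I]) Q i).
  by apply: fin_bigcap_measurable => //; exact: finite_finset.
by apply/seteqP; split=> w h i //; exact: h.
Qed.

Lemma exists_measurable (I : finType) (Q : I -> set T) :
  (forall i, measurable (Q i)) -> measurable [set w | exists i, Q i w].
Proof.
move=> mQ; rewrite [X in measurable X](_ : _ = \bigcup_(i in [set: I]) Q i).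
  by apply: fin_bigcup_measurable => //; exact: finite_finset.
by apply/seteqP; split=> w [i]; [exists i|exists i].
Qed.

End Probability.

(** * Outcomes of a single slot *)

Notation slot := (bool * bool * (bool * bool) * (bool * bool))%type.

(** A [slot] concerns one CP: the bits of CU 1 and of CU 2 towards the two eRRHs, then the command
    bits of the two eRRHs. A pair of slots covers both CPs. *)
Definition slot_requests (o : slot * slot) (m n k : 'I_2) : bool :=
  sel (sel (sel o k).1 m) n.

Definition slot_commands (o : slot * slot) (n k : 'I_2) : bool :=
  sel (sel o k).2 n.

Definition slot_received (n : 'I_2) (o : slot) : bool :=
  (sel o.2 n * (sel o.1.1 n + sel o.1.2 n) == 1)%N.

Lemma receivedE x c n k t o :
    (forall m n k, x t m n k = slot_requests o m n k) ->
    (forall n k, c t n k = slot_commands o n k) ->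
  received x c n k t = slot_received n (sel o k).
Proof. by move=> xo co; rewrite /received big_ord2/= !xo co. Qed.

Lemma aoi_ext x c x' c' n k t :
    (forall s, (s < t)%N -> (forall m n k, x s m n k = x' s m n k) /\
       (forall n k, c s n k = c' s n k)) ->
  aoi x c n k t = aoi x' c' n k t.
Proof.
elim: t => //= t IH h; rewrite IH; last by move=> s st; apply: h; exact: ltnW.
have [xt ct] := h t (ltnSn t).
by rewrite /received ct; under eq_bigr do rewrite xt.
Qed.

(** The joint law of the two request bits of one CU for one CP. At most one bit is set and the
    marginals [p] and [1 - p] add up to 1, so almost surely exactly one is. *)
Definition request_weight (R : realType) (p : R) (u : bool * bool) : R :=
  match u with (true, false) => p | (false, true) => 1 - p | _ => 0 end.

Definition slot_weight (R : realType) (p : R) (q : R * R) (o : slot) : R :=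
  request_weight p o.1.1 * request_weight p o.1.2 *
  (bernoulli_weight q.1 o.2.1 * bernoulli_weight q.2 o.2.2).

Lemma sum_pair (V : nmodType) (I J : finType) (F : I * J -> V) :
  \sum_p F p = \sum_i \sum_j F (i, j).
Proof. by rewrite pair_bigA; apply: eq_bigr => -[]. Qed.

(** Exactly one of two independent CUs picks eRRH [n] with probability 2 b (1 - b), the same for
    both eRRHs as their [b] add up to 1; the command thins this by [sel q n], and the command of the
    other eRRH sums out. *)
Lemma sum_slot_weight (R : realType) (b : 'I_2 -> R) (q : R * R) n (a : bool) :
    b idx1 + b idx2 = 1 ->
  \sum_(o | slot_received n o == a) slot_weight (b idx1) q o =
  bernoulli_weight (sel q n * (2 * (b n * (1 - b n)))) a.
Proof.
move=> b1; have -> : b n * (1 - b n) = b idx1 * (1 - b idx1).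
  have -> : b idx1 = 1 - b idx2 by rewrite -b1 addrK.
  by case: (ord2P n) => ->; rewrite -?b1; ring.
move: (b idx1) => p; rewrite big_mkcond sum_pair sum_pair.
rewrite !sum_bool2 /slot_weight /slot_received /sel/=.
by case: (n == idx1); case: a; rewrite /= ?(mul0r, mulr0, addr0, add0r); ring.
Qed.

Lemma minnS_minn g z : minn (minn g z).+1 z = minn g.+1 z.
Proof. by lia. Qed.

(** * Markov property of the truncated ages *)

Section NetworkLaw.
Context (d : measure_display) (T : measurableType d) (R : realType).
Context (P : probability T R) (b : 'I_2 -> 'I_2 -> R) (r1 r2 : R) (z : nat).
Context (tie : tie_rule).
Context (beta : nat -> 'I_2 -> 'I_2 -> 'I_2 -> T -> bool).
Context (gamma : nat -> 'I_2 -> 'I_2 -> T -> bool).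
Hypothesis hb : forall n k, 0 <= b n k <= 1.
Hypothesis hr1 : 0 <= r1 <= 1.
Hypothesis hr2 : 0 <= r2 <= 1.
Hypothesis hb1 : forall k, b idx1 k + b idx2 k = 1.
Hypothesis hz : (2 <= z)%N.
Hypothesis hnet : nsr_network P b r1 r2 z tie beta gamma.

Local Notation age := (age beta gamma).
Local Notation receipt := (receipt beta gamma).
Local Notation in_state := (in_state beta gamma).
Local Notation prob := (pr P).

Definition obs (t : nat) (w : T) : slot * slot :=
  let o k := (((beta t idx1 idx1 k w, beta t idx1 idx2 k w),
               (beta t idx2 idx1 k w, beta t idx2 idx2 k w)),
              (gamma t idx1 k w, gamma t idx2 k w)) in
  (o idx1, o idx2).

Lemma obs_requests t w m n k : slot_requests (obs t w) m n k = beta t m n k w.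
Proof. by rewrite /slot_requests /sel; case: (ord2P k) (ord2P m) (ord2P n) => -> [] -> [] ->. Qed.

Lemma obs_commands t w n k : slot_commands (obs t w) n k = gamma t n k w.
Proof. by rewrite /slot_commands /sel; case: (ord2P k) (ord2P n) => -> [] ->. Qed.

Lemma obsP t w o : obs t w = o <->
  (forall m n k, beta t m n k w = slot_requests o m n k) /\
  (forall n k, gamma t n k w = slot_commands o n k).
Proof.
split=> [<-|[xo co]].
  by split=> *; rewrite ?obs_requests ?obs_commands.
rewrite /obs !xo !co /slot_requests /slot_commands /sel /=.
by case: o {xo co} => -[[[? ?] [? ?]] [? ?]] [[[? ?] [? ?]] [? ?]].
Qed.

Lemma receiptE n k t w : receipt n k t w = slot_received n (sel (obs t w) k).
Proof.
by apply: receivedE => *; rewrite ?obs_requests ?obs_commands.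
Qed.

Lemma measurable_obs t o : measurable [set w | obs t w = o].
Proof.
have mbool (f : T -> bool) v : measurable_fun setT f -> measurable [set w | f w = v].
  by move=> mf; have := mf measurableT [set v]; rewrite setTI; apply.
rewrite [X in measurable X](_ : _ =
    [set w | forall m n k, beta t m n k w = slot_requests o m n k] `&`
    [set w | forall n k, gamma t n k w = slot_commands o n k]); last first.
  by apply/seteqP; split=> w /= /obsP.
apply: measurableI.
  do 3 apply: forall_measurable => ?.
  by apply: mbool; exact: (nsr_measurable_beta hnet).
do 2 apply: forall_measurable => ?.
by apply: mbool; exact: (nsr_measurable_gamma hnet).
Qed.

(** Measurability with respect to the first [t] slots, stated pointwise: [A] is a union of cells of
    the finite partition by past observations. *)
Definition determined (t : nat) (A : set T) :=
  forall w w', (forall s, (s < t)%N -> obs s w = obs s w') -> A w -> A w'.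

Let past t w : {ffun 'I_t -> slot * slot} := [ffun i : 'I_t => obs i w].

Let pastP t w w' : past t w = past t w' <->
  forall s, (s < t)%N -> obs s w = obs s w'.
Proof.
split=> [/ffunP e s st|e]; first by have := e (Ordinal st); rewrite !ffunE.
by apply/ffunP => i; rewrite !ffunE e.
Qed.

Let measurable_past t h : measurable [set w | past t w = h].
Proof.
rewrite [X in measurable X](_ : _ = [set w | forall i : 'I_t, obs i w = h i]).
  by apply: forall_measurable => i; exact: measurable_obs.
apply/seteqP; split=> w /=; first by move=> <- i; rewrite ffunE.
by move=> e; apply/ffunP => i; rewrite ffunE e.
Qed.

Lemma determined_measurable t A : determined t A -> measurable A.
Proof.
move=> detA; rewrite [X in measurable X](_ : _ =
    [set w | exists h, (past t w = h) /\ exists2 w', A w' & past t w' = h]).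
  apply: exists_measurable => h.
  have [ex|nex] := pselect (exists2 w', A w' & past t w' = h).
    rewrite [X in measurable X](_ : _ = [set w | past t w = h])//.
    by apply/seteqP; split=> w /=; [case|].
  rewrite [X in measurable X](_ : _ = set0)//.
  by apply/seteqP; split=> w //= [].
apply/seteqP; split=> w /=; first by move=> Aw; exists (past t w); split=> //; exists w.
by move=> [h [<- [w' Aw' /pastP e]]]; exact: detA e Aw'.
Qed.

Lemma determinedW t t' A : (t <= t')%N -> determined t A -> determined t' A.
Proof. by move=> tt' detA w w' e; apply: detA => s st; apply: e; exact: leq_trans tt'. Qed.

Lemma determinedI t A B : determined t A -> determined t B -> determined t (A `&` B).
Proof. by move=> dA dB w w' e [Aw Bw]; split; [exact: dA e Aw|exact: dB e Bw]. Qed.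

Lemma age_obs t w w' n k : (forall s, (s < t)%N -> obs s w = obs s w') ->
  age n k t w = age n k t w'.
Proof.
move=> e; apply: aoi_ext => s st.
by split=> *; rewrite -?obs_requests -?obs_commands e.
Qed.

Lemma determined_in_state n t (phi : state z) : determined t (in_state n t phi).
Proof. by move=> w w' e st k; rewrite -(age_obs _ _ e). Qed.

(** The marginals determine the joint law: two requests at once are excluded, a single request is
    then a marginal event, and the event of no request is the complement of a set of probability
    [b idx1 k + b idx2 k = 1]. *)
Lemma request_law t m k (x : 'I_2 -> bool) :
  P [set w | forall n, beta t m n k w = x n] =
  (request_weight (b idx1 k) (x idx1, x idx2))%:E.
Proof.
have hP n := nsr_request_prob hnet t m n k.
have b2 : 1 - b idx1 k = b idx2 k by rewrite -(hb1 k) addrC addKr.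
have one w : ~~ (beta t m idx1 k w && beta t m idx2 k w).
  have := nsr_one_request hnet t m k w; rewrite big_ord2/=.
  by case: (beta _ _ _ _ _); case: (beta _ _ _ _ _).
have mb n v : measurable [set w | beta t m n k w = v].
  by have := nsr_measurable_beta hnet t m n k measurableT (I : measurable [set v]); rewrite setTI.
have forall2 (Q : 'I_2 -> Prop) : (forall n, Q n) <-> Q idx1 /\ Q idx2.
  by split=> [h|[h1 h2] n]; [split|case: (ord2P n) => ->].
case x1 : (x idx1); case x2 : (x idx2); rewrite /request_weight.
- rewrite (_ : [set w | _] = set0) ?measure0//; apply/seteqP; split=> // w /=.
  by move=> /forall2[]; rewrite x1 x2 => e1 e2; have := one w; rewrite e1 e2.
- rewrite -hP; congr (P _); apply/seteqP; split=> w /=.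
    by move=> /forall2[]; rewrite x1.
  move=> e1; apply/forall2; rewrite x1 x2; split=> //.
  by have := one w; rewrite e1 /= => /negbTE.
- rewrite b2 -hP; congr (P _); apply/seteqP; split=> w /=.
    by move=> /forall2[]; rewrite x2.
  move=> e1; apply/forall2; rewrite x1 x2; split=> //.
  by have := one w; rewrite e1 andbT => /negbTE.
- pose A n := [set w | beta t m n k w = true].
  have PA : P (A idx1 `|` A idx2) = 1%E.
    rewrite measureU; [|exact: mb|exact: mb|].
      by rewrite -(hb1 k) EFinD -!hP.
    apply/seteqP; split=> // w [] /= e1 e2.
    by have := one w; rewrite e1 e2.
  rewrite (_ : [set w | _] = ~` (A idx1 `|` A idx2)).
    rewrite probability_setC ?PA ?subee//.
    by apply: measurableU; exact: mb.
  apply/seteqP; split=> w /=.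
    by move=> /forall2[]; rewrite x1 x2 => e1 e2; rewrite /A /= e1 e2 => -[].
  rewrite /A/= => /not_orP[/negP e1 /negP e2]; apply/forall2; rewrite x1 x2.
  by split; apply/negbTE.
Qed.

Lemma obs_law t w0 o :
  prob ([set w | forall s, (s < t)%N -> obs s w = obs s w0] `&` [set w | obs t w = o]) =
  prob [set w | forall s, (s < t)%N -> obs s w = obs s w0] *
  (slot_weight (b idx1 idx1)
     (command_prob tie r1 r2 z (age idx1 idx1 t w0) (age idx1 idx2 t w0) idx1,
      command_prob tie r1 r2 z (age idx2 idx1 t w0) (age idx2 idx2 t w0) idx1) o.1 *
   slot_weight (b idx1 idx2)
     (command_prob tie r1 r2 z (age idx1 idx1 t w0) (age idx1 idx2 t w0) idx2,
      command_prob tie r1 r2 z (age idx2 idx1 t w0) (age idx2 idx2 t w0) idx2) o.2).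
Proof.
(* Splicing the past of [w0] with the outcome [o] turns the chain rule for deterministic histories
   into a statement about the cell of [w0]. *)
pose x s m n k := if (s < t)%N then beta s m n k w0 else slot_requests o m n k.
pose c s n k := if (s < t)%N then gamma s n k w0 else slot_commands o n k.
have histE : history beta gamma x c t =
    [set w | forall s, (s < t)%N -> obs s w = obs s w0].
  apply/seteqP; split=> w /= h s st; have := h s st; rewrite /x /c st.
    move=> [xs cs]; apply/obsP; split=> *; rewrite ?obs_requests ?obs_commands.
      exact: xs.
    exact: cs.
  by move=> /obsP[xs cs]; split=> *; rewrite ?xs ?cs ?obs_requests ?obs_commands.
have histSE : history beta gamma x c t.+1 =
    [set w | forall s, (s < t)%N -> obs s w = obs s w0] `&` [set w | obs t w = o].
  rewrite -histE; apply/seteqP; split=> w /=.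
    move=> h; split; first by move=> s st; apply: h; exact: ltnW.
    by have := h t (ltnSn t); rewrite /x /c ltnn => /obsP.
  move=> [h /obsP ho] s; rewrite ltnS leq_eqVlt => /orP[/eqP ->|]; last exact: h.
  by rewrite /x /c ltnn.
have ageE n k : aoi x c n k t = age n k t w0.
  by apply: aoi_ext => s st; rewrite /x /c st.
have xt m n k : x t m n k = slot_requests o m n k by rewrite /x ltnn.
have ct n k : c t n k = slot_commands o n k by rewrite /c ltnn.
have := nsr_law hnet x c t; rewrite histE histSE !big_ord2/=.
rewrite !request_law !ageE !xt !ct {1}/pr => ->.
have mh : measurable [set w | forall s, (s < t)%N -> obs s w = obs s w0].
  apply: (@determined_measurable t) => w w' e h s st.
  by rewrite -e// h.
rewrite (prE P mh) -!EFinM/= /slot_weight /slot_requests /slot_commands /sel/=.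
by case: o {x c histE histSE ageE xt ct} => -[[[? ?] [? ?]] [? ?]] [[[? ?] [? ?]] [? ?]] /=; ring.
Qed.


Definition receipts n t (a : bool * bool) : set T :=
  [set w | forall k, receipt n k t w = sel a k].

Lemma receiptsP n t a w : receipts n t a w <->
  (slot_received n (obs t w).1 == a.1) && (slot_received n (obs t w).2 == a.2).
Proof.
rewrite /receipts /=; split=> [h|/andP[/eqP e1 /eqP e2] k].
  by have := h idx1; have := h idx2; rewrite !receiptE /sel/= => -> ->; rewrite !eqxx.
by rewrite receiptE /sel; case: ifP.
Qed.

(** The sum of [obs_law] over the outcomes compatible with [a] factors over the two CPs, each factor
    being a Bernoulli weight. The true ages enter only through the truncated state [phi]. *)
Lemma receipts_law n t (phi : state z) w0 a : in_state n t phi w0 ->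
  prob ([set w | forall s, (s < t)%N -> obs s w = obs s w0] `&` receipts n t a) =
  prob [set w | forall s, (s < t)%N -> obs s w = obs s w0] *
  reset_weight b r1 r2 tie n phi a.
Proof.
move=> st; set C := [set w | _].
have mC : measurable C.
  by apply: (@determined_measurable t) => w w' e h s ts; rewrite -e// h.
have mR : measurable (receipts n t a).
  rewrite [X in measurable X](_ : _ = [set w | exists o, obs t w = o /\
      (slot_received n o.1 == a.1) && (slot_received n o.2 == a.2)]).
    apply: exists_measurable => o; case: (_ && _) => /=.
      rewrite [X in measurable X](_ : _ = [set w | obs t w = o]).
        exact: measurable_obs.
      by apply/seteqP; split=> w //= [].
    by rewrite [X in measurable X](_ : _ = set0)//; apply/seteqP; split=> w //= [].
  apply/seteqP; split=> w /=; first by move=> /receiptsP h; exists (obs t w).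
  by move=> [oo [ <- h]]; apply/receiptsP.
rewrite (@pr_partition _ _ _ _ _ (obs t) (C `&` _) (measurable_obs t)); last exact: measurableI.
pose W (k : 'I_2) := slot_weight (b idx1 k)
  (command_prob tie r1 r2 z (age idx1 idx1 t w0) (age idx1 idx2 t w0) k,
   command_prob tie r1 r2 z (age idx2 idx1 t w0) (age idx2 idx2 t w0) k).
transitivity (prob C * \sum_(o | (slot_received n o.1 == a.1) &&
    (slot_received n o.2 == a.2)) W idx1 o.1 * W idx2 o.2).
  rewrite big_distrr [RHS]big_mkcond/=; apply: eq_bigr => o _.
  case: ifP => ho; last first.
    rewrite -(pr0 P); congr pr; apply/seteqP; split=> // w [[_ /receiptsP +] /= oE].
    by rewrite oE ho.
  rewrite -obs_law; congr pr; apply/seteqP; split=> w /=; first by move=> [[]].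
  by move=> [Cw oE]; split=> //; split=> //; apply/receiptsP; rewrite oE.
congr (_ * _); rewrite -(pair_big (fun o => slot_received n o == a.1)
  (fun o => slot_received n o == a.2) (fun o1 o2 => W idx1 o1 * W idx2 o2))/=.
rewrite -big_distrlr/= /W.
rewrite (@sum_slot_weight _ (b^~ idx1))// (@sum_slot_weight _ (b^~ idx2))//.
rewrite !(sel_pair (fun n => command_prob tie r1 r2 z (age n idx1 t w0) (age n idx2 t w0) _)).
by rewrite !(command_probE _ _ _ _ (g := fun k => age n k t w0) st).
Qed.

(** [A] is a union of cells of the past. On each of them the receipts have the same conditional law,
    because all cells lie in state [phi]. *)
Lemma markov_step n t (phi : state z) A a :
    determined t A -> A `<=` in_state n t phi ->
  prob (A `&` receipts n t a) = prob A * reset_weight b r1 r2 tie n phi a.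
Proof.
move=> detA Aphi; have mA := determined_measurable detA.
have mR : measurable (receipts n t a).
  apply: (@determined_measurable t.+1) => w w' e h k.
  by rewrite -h !receiptE e.
rewrite (pr_partition P (@measurable_past t) mA).
rewrite (pr_partition P (@measurable_past t) (measurableI _ _ mA mR)).
rewrite mulr_suml; apply: eq_bigr => h _.
have [[w0 Aw0 <-]|nex] := pselect (exists2 w, A w & past t w = h); last first.
  rewrite (_ : A `&` [set w | past t w = h] = set0); last first.
    by apply/seteqP; split=> // w [Aw hw]; case: nex; exists w.
  rewrite (_ : _ `&` [set w | past t w = h] = set0) ?pr0 ?mul0r//.
  by apply/seteqP; split=> // w [[Aw _] hw]; case: nex; exists w.
have CE : A `&` [set w | past t w = past t w0] =
    [set w | forall s, (s < t)%N -> obs s w = obs s w0].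
  apply/seteqP; split=> w /=; first by move=> [_ /pastP].
  move=> e; split; last exact/pastP.
  by apply: detA Aw0 => s st; rewrite e.
by rewrite setIAC CE; apply: receipts_law; exact: Aphi.
Qed.

Lemma ageS n k t w : age n k t.+1 w =
  if receipt n k t w then 1%N else (age n k t w).+1.
Proof. by []. Qed.

Lemma age_gt0 n k t w : (0 < age n k t w)%N.
Proof. by case: t => // t; rewrite ageS; case: ifP. Qed.

Lemma in_stateS n t (phi : state z) a w :
  in_state n t phi w -> receipts n t a w -> in_state n t.+1 (next phi a) w.
Proof.
move=> st ra k; rewrite ageS ra level_next//.
by case: ifP => _; [apply/minn_idPl; exact: ltnW|rewrite -st minnS_minn].
Qed.

Lemma determined_receipts n t a : determined t.+1 (receipts n t a).
Proof. by move=> w w' e h k; rewrite -h !receiptE e. Qed.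

Lemma sum_receipts n t (A : set T) : measurable A ->
  prob A = \sum_a prob (A `&` receipts n t a).
Proof.
pose f w := (receipt n idx1 t w, receipt n idx2 t w).
have fE a : [set w | f w = a] = receipts n t a.
  apply/seteqP; split=> w /=.
    by move=> <- k'; rewrite (sel_pair (fun k => receipt n k t w)).
  move=> h; rewrite /f (h idx1) (h idx2) /sel/=.
  by case: a {h}.
have mf a : measurable [set w | f w = a].
  by rewrite fE; exact: (determined_measurable (@determined_receipts n t a)).
by move=> mA; rewrite (pr_partition P mf mA); apply: eq_bigr => a _; rewrite fE.
Qed.

(** * Ages and waiting times as counts of windows without receipt *)

Definition no_receipt n k t j : set T :=
  [set w | forall i, (i < j)%N -> receipt n k (t + i) w = false].

Lemma determined_no_receipt n k t j : determined (t + j) (no_receipt n k t j).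
Proof. by move=> w w' e h i ij; rewrite -(h i ij) !receiptE e// ltn_add2l. Qed.

Lemma no_receiptS n k t j w : no_receipt n k t j.+1 w <->
  receipt n k t w = false /\ no_receipt n k t.+1 j w.
Proof.
split=> [h|[h0 h] [_|i ij]].
- split; first by rewrite -(h 0%N)// addn0.
  by move=> i ij; rewrite addSnnS h.
- by rewrite addn0.
- by rewrite -addSnnS h.
Qed.

Local Notation M n := (@Pc R z b r1 r2 tie n).

(** Conditioning on the receipts of the first slot gives an event determined by time [t.+1] and
    contained in state [next phi a], to which the induction applies; the receipts that include [k]
    contribute nothing. *)
Lemma no_receipt_law n k t j (phi : state z) A :
    determined t A -> A `<=` in_state n t phi ->
  prob (A `&` no_receipt n k t j) =
  prob A * survival (M n) (fun phi => level phi k != 1%N) j phi.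
Proof.
elim: j t phi A => [|j IH] t phi A detA Aphi.
  by rewrite mulr1; congr pr; apply/seteqP; split=> [w []|w Aw].
have mA := determined_measurable detA.
have mN := determined_measurable (determined_no_receipt (n := n) (k := k) (t := t) (j := j.+1)).
rewrite (sum_receipts n t (measurableI _ _ mA mN)) /survival iterS killed_Pc//.
rewrite mulr_sumr; apply: eq_bigr => a _; rewrite mulrA.
rewrite -(markov_step _ detA Aphi).
case: ifP => ak.
  rewrite mulr0 -(pr0 P); congr pr; apply/seteqP; split=> // w [[_ /no_receiptS[]]] + _ h.
  by rewrite h ak.
rewrite -(IH t.+1 (next phi a) (A `&` receipts n t a)).
- congr pr; apply/seteqP; split=> w.
    by move=> [[Aw /no_receiptS[_ h]] r].
  by move=> [[Aw r] h]; do 2 (split=> //); apply/no_receiptS; rewrite r.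
- apply: determinedI; first exact: determinedW (leqnSn t) detA.
  exact: determined_receipts.
- by move=> w [Aw r]; apply: in_stateS => //; exact: Aphi.
Qed.

Definition state_of n t w : state z :=
  [ffun k => insubd (Ordinal hz) (minn (age n k t w) z).-1].

Lemma state_ofP n t w phi : state_of n t w = phi <-> in_state n t phi w.
Proof.
have lev k : level (state_of n t w) k = minn (age n k t w) z.
  have min_gt0 : (0 < minn (age n k t w) z)%N by rewrite leq_min age_gt0 ltnW.
  by rewrite /level ffunE val_insubd prednK// geq_minr prednK.
split=> [ <- k|h]; first by rewrite lev.
by apply: level_inj => k; rewrite lev h.
Qed.

Definition state_prob n t (phi : state z) : R := prob (in_state n t phi).

Lemma sum_in_state n t (A : set T) : measurable A ->
  prob A = \sum_(phi : state z) prob (in_state n t phi `&` A).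
Proof.
have E phi : [set w | state_of n t w = phi] = in_state n t phi.
  by apply/seteqP; split=> w /state_ofP.
move=> mA; rewrite (@pr_partition _ _ _ P _ (state_of n t) A)//.
  by apply: eq_bigr => phi _; rewrite E setIC.
by move=> phi; rewrite E; apply: determined_measurable; exact: determined_in_state.
Qed.

Lemma state_prob_ge0 n t phi : 0 <= state_prob n t phi.
Proof. exact: pr_ge0. Qed.

Lemma sum_state_prob n t : \sum_phi state_prob n t phi = 1.
Proof.
rewrite -(pr_setT P) (sum_in_state n t measurableT).
by apply: eq_bigr => phi _; rewrite setIT.
Qed.

Lemma state_probS n t phi' :
  state_prob n t.+1 phi' = \sum_phi state_prob n t phi * M n phi phi'.
Proof.
have mS := determined_measurable (@determined_in_state n t.+1 phi').
rewrite /state_prob (sum_in_state n t mS); apply: eq_bigr => phi _.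
have dphi := @determined_in_state n t phi.
have mphi := determined_measurable dphi.
rewrite (sum_receipts n t (measurableI _ _ mphi mS)) PcE// mulr_sumr.
apply: eq_bigr => a _; rewrite mulrA -(markov_step _ dphi (@subset_refl _ _)).
have [->|ne] := eqVneq phi' (next phi a).
  rewrite mulr1; congr pr; apply/seteqP; split=> w; first by move=> [[]].
  by move=> [h r]; split=> //; split=> //; exact: in_stateS.
rewrite mulr0 -(pr0 P); congr pr; apply/seteqP; split=> // w [[h h'] r].
move/eqP: ne; apply; apply: level_inj => k.
by rewrite -h' (in_stateS h r).
Qed.

Lemma age_gtE n k t j w : (j <= t)%N ->
  (j < age n k t w)%N <-> no_receipt n k (t - j) j w.
Proof.
elim: t j => [|t IH] [|j]; rewrite ?subn0.
- by [].
- by [].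
- by move=> _; split=> // _; exact: age_gt0.
rewrite ltnS => jt; rewrite ageS subSS.
have NE : no_receipt n k (t - j) j.+1 w <->
    receipt n k t w = false /\ no_receipt n k (t - j) j w.
  split=> [h|[h0 h] i].
    by split=> [|i ij]; [rewrite -{1}(subnK jt) h|rewrite h// ltnW].
  by rewrite ltnS leq_eqVlt => /orP[/eqP ->|]; [rewrite subnK|exact: h].
split=> [|/NE[-> /(IH _ jt)]]; last by rewrite ltnS.
by case: ifP => // r; rewrite ltnS => /(IH _ jt) h; apply/NE.
Qed.

Lemma age_le n k t w : (age n k t w <= t.+1)%N.
Proof. by elim: t => // t IH; rewrite ageS; case: ifP. Qed.

(** The tail-sum formula, with each tail event read as a window without receipt and decomposed over
    the truncated state at time [t - j]. *)
Lemma expected_age n k t : ('E_P[fun w => (age n k t w)%:R : R] =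
  (mean_age (M n) (fun phi => level phi k != 1%N) (state_prob n) t)%:E)%E.
Proof.
have mN j : measurable (no_receipt n k (t - j) j).
  exact: (determined_measurable (@determined_no_receipt n k (t - j) j)).
(* The age counts the [j] below it; since it is at most [t.+1], the sum over [j <= t] misses
   none. *)
have ageE w : ((age n k t w)%:R%:E =
    \sum_(j < t.+1) (\1_(no_receipt n k (t - j) j) w : R)%:E)%E.
  rewrite sumEFin; congr EFin.
  transitivity (\sum_(j < t.+1) (j < age n k t w)%N%:R : R).
    rewrite -natr_sum; congr (_%:R).
    rewrite -(big_mkord xpredT (fun j => (j < age n k t w)%N : nat)).
    rewrite (big_cat_nat (leq0n _) (age_le n k t w))/=.
    rewrite [X in (X + _)%N](_ : _ = \sum_(0 <= j < age n k t w) 1)%N; last first.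
      by apply: eq_big_nat => j /= ->.
    rewrite sum_nat_const_nat subn0 muln1 big1_seq ?addn0// => j.
    by rewrite mem_index_iota => /andP[_ /andP[+ _]]; rewrite leqNgt => /negbTE ->.
  apply: eq_bigr => j _; rewrite indicE; congr (_%:R).
  congr nat_of_bool; apply/idP/idP; rewrite inE => /age_gtE; apply;
    by rewrite -ltnS.
rewrite unlock; under eq_integral do rewrite ageE.
rewrite ge0_integral_sum//; last first.
  by move=> j; apply/measurable_EFinP; exact: measurable_indic.
rewrite (eq_bigr (fun j : 'I_t.+1 => (prob (no_receipt n k (t - j) j))%:E)); last first.
  by move=> j _; rewrite integral_indic// setIT; exact: prE.
rewrite sumEFin; congr EFin; apply: eq_bigr => j _.
rewrite (sum_in_state n (t - j) (mN j)); apply: eq_bigr => phi _.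
by apply: no_receipt_law => //; exact: determined_in_state.
Qed.

(** If the first receipt occurs in slot [t + i], the waiting time is [i + 1] and exactly the terms
    [j <= i] equal 1. Without any receipt both sides are infinite, the infimum of the empty set
    being [+oo]. *)
Lemma waiting_timeE n k t w : (waiting_time R beta gamma n k t w =
  \sum_(0 <= j <oo) (\1_(no_receipt n k t j) w : R)%:E)%E.
Proof.
have [[i0 ri0]|never] := pselect (exists i, receipt n k (t + i) w); last first.
  rewrite /waiting_time [X in ereal_inf X](_ : _ = set0); last first.
    apply/seteqP; split=> // x [j [j0 r] jx]; case: never; exists j.-1.
    by rewrite -subn1 addnBA// subn1.
  rewrite ereal_inf0; apply/esym/eqyP => A A0.
  pose N := (Num.trunc A).+1.
  apply: (@le_trans _ _ (\sum_(0 <= j < N) (\1_(no_receipt n k t j) w : R)%:E)%E); last first.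
    by apply: nneseries_lim_ge => j _ _; rewrite lee_fin.
  rewrite sumEFin lee_fin (eq_bigr (fun=> 1)).
    by rewrite sumr_const_nat subn0 ltW// truncnS_gt.
  move=> j _; rewrite indicE mem_set// => i _; apply/negP => r.
  by apply: never; exists i.
have [i ri imin] := ex_minnP (ex_intro (fun i => receipt n k (t + i) w) i0 ri0).
transitivity (i.+1%:R : R)%:E.
  apply/eqP; rewrite eq_le; apply/andP; split.
    apply: ereal_inf_lbound; exists i.+1 => //; split=> //.
    by rewrite addnS.
  apply: le_ereal_inf_tmp => _ [j [j0 r] <-]; rewrite lee_fin ler_nat.
  rewrite -(prednK j0) ltnS imin//.
  by rewrite -subn1 addnBA// subn1.
apply/esym; rewrite (nneseries_split _ i.+1)//.
rewrite eseries0 ?adde0; last first.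
  move=> j ij _; rewrite indicE memNset// => /(_ i ij); by rewrite ri.
rewrite add0n sumEFin (eq_big_nat _ _ (F2 := fun=> 1)).
  by rewrite sumr_const_nat subn0.
move=> j /= ji; rewrite indicE mem_set// => l lj; apply/negP => /imin.
by rewrite leqNgt (leq_trans lj).
Qed.

(** Integrating the nonnegative series termwise reduces the mean to [no_receipt_law]. The product
    form avoids dividing by the probability of the state, which may be 0. *)
Lemma integral_waiting_time n k t (phi : state z) :
  (\int[P]_(w in in_state n t phi) waiting_time R beta gamma n k t w =
   (\sum_(0 <= j <oo)
     (survival (M n) (fun phi => level phi k != 1%N) j phi)%:E) *
   P (in_state n t phi))%E.
Proof.
have dS := @determined_in_state n t phi.
have mS := determined_measurable dS.
have mN j : measurable (no_receipt n k t j).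
  exact: (determined_measurable (@determined_no_receipt n k t j)).
under eq_integral do rewrite waiting_timeE.
rewrite integral_nneseries//; last first.
- by move=> j; apply: measurable_funTS; apply/measurable_EFinP; exact: measurable_indic.
rewrite (prE P mS) muleC -nneseriesZl; last first.
  by move=> j _; rewrite lee_fin survival_ge0//; exact: Pc_ge0.
apply: eq_eseriesr => j _; rewrite integral_indic// setIC.
rewrite -EFinM -(no_receipt_law k j dS (@subset_refl _ _)).
by apply: prE; exact: measurableI.
Qed.

End NetworkLaw.

(** * Convergence of the average age to the stationary mean *)

Lemma cvg_mean_age (R : realType) (z : nat) (b : 'I_2 -> 'I_2 -> R) (r1 r2 : R)
    (tie : tie_rule) (n k : 'I_2) (mu : nat -> state z -> R)
    (p : {ffun state z -> R}) (M := @Pc R z b r1 r2 tie n) :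
    (forall n k, 0 <= b n k <= 1) -> 0 <= r1 <= 1 -> 0 <= r2 <= 1 ->
    (2 <= z)%N ->
    (forall t phi, 0 <= mu t phi) -> (forall t, \sum_phi mu t phi = 1) ->
    (forall t phi', mu t.+1 phi' = \sum_phi mu t phi * M phi phi') ->
    stationary M p ->
  (fun N : nat => (N%:R^-1 * \sum_(1 <= t < N.+1)
      mean_age M (fun phi => level phi k != 1%N) mu t)%:E) @ \oo -->
    (\sum_(phi : state z) expected_reset M k phi * (p phi)%:E)%E.
Proof.
move=> hb hr1 hr2 hz mu_ge0 mu_sum muS [p_ge0 p_sum pM].
have M_ge0 := Pc_ge0 tie n hb hr1 hr2 hz.
have M_sum := Pc_sum1 b r1 r2 tie n hz.
have [/andP[hbk hr12]|deg] := boolP ((0 < b n k < 1) && (0 < r1 + r2)).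
  have [f [FE f_ge0 fE]] := expected_reset_finite tie hb hr1 hr2 hz hbk hr12.
  rewrite (eq_bigr (fun phi => (p phi * f phi)%:E)); last first.
    by move=> phi _; rewrite FE muleC.
  rewrite sumEFin; apply: cvg_EFin; first exact: nearW.
  exact: (mean_age_average M_ge0 M_sum (Pc_up tie n hb hr1 hr2 hz) (iter_up hz)).
(* Here the claimed limit is [+oo] times the total mass 1 of [p], where states of mass 0 contribute
   [+oo * 0 = 0]. *)
have FE := expected_reset_pinfty tie hb hr1 hr2 hz deg.
rewrite (eq_bigr (fun phi => +oo * (p phi)%:E)%E); last by move=> phi _; rewrite FE.
rewrite -ge0_sume_distrr; last by move=> phi _; rewrite lee_fin.
rewrite sumEFin p_sum mule1; apply: cvg_mean_pinfty => t.
apply: mean_age_survival1 => // j phi.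
exact: (survival_eq1 tie hb hr1 hr2 hz deg).
Qed.

Theorem proposition3 (d : measure_display) (T : measurableType d) (R : realType)
    (P : probability T R)
    (b : 'I_2 -> 'I_2 -> R) (r1 r2 : R) (z : nat) (tie : tie_rule)
    (beta : nat -> 'I_2 -> 'I_2 -> 'I_2 -> T -> bool)
    (gamma : nat -> 'I_2 -> 'I_2 -> T -> bool)
    (hb : forall n k, 0 <= b n k <= 1)
    (hb1 : forall k, b idx1 k + b idx2 k = 1)
    (hr1 : 0 <= r1 <= 1) (hr2 : 0 <= r2 <= 1) (hr : r2 <= r1)
    (hz : (2 <= z)%N)
    (hnet : nsr_network P b r1 r2 z tie beta gamma) :
  let M := fun n : 'I_2 => @Pc R z b r1 r2 tie n in
  let F := fun n k : 'I_2 => expected_reset (M n) k in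
  [/\
      forall (n k : 'I_2) (t : nat) (phi : state z),
        (\int[P]_(w in in_state beta gamma n t phi)
            waiting_time R beta gamma n k t w
         = F n k phi * P (in_state beta gamma n t phi))%E,
      forall n k : 'I_2,
        [/\ reset_system (M n) k (F n k),
            forall f : state z -> R,
              reset_system (M n) k (fun phi => (f phi)%:E) ->
              forall phi, F n k phi = (f phi)%:E &
            0 < b n k < 1 -> 0 < r1 + r2 ->
              forall phi, F n k phi \is a fin_num],
      forall n : 'I_2, exists! p : {ffun state z -> R}, stationary (M n) p &
      forall p : 'I_2 -> {ffun state z -> R},
        (forall n, stationary (M n) (p n)) ->
        average_age P beta gamma @ \oo -->
        ((4^-1)%:E * \sum_(n < 2) \sum_(k < 2) \sum_(phi : state z)
            F n k phi * (p n phi)%:E)%E].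
Proof.
move=> M F.
have M_ge0 n := Pc_ge0 tie n hb hr1 hr2 hz.
have M_sum n := Pc_sum1 b r1 r2 tie n hz.
have M_up n := Pc_up tie n hb hr1 hr2 hz.
split.
- move=> n k t phi; rewrite (integral_waiting_time hb hr1 hr2 hb1 hz hnet).
  congr (_ * _)%E; apply/esym.
  exact: (expected_resetE tie n hb hr1 hr2 hz k phi).
- move=> n k; split.
  + exact: expected_reset_system.
  + exact: expected_reset_unique.
  + move=> hbk hr12 phi.
    have [f [FE _ _]] := expected_reset_finite tie hb hr1 hr2 hz hbk hr12.
    by have -> : F n k phi = (f phi)%:E by exact: FE.
- move=> n.
  have [p [p_ge0 p_sum pM]] := stationary_exists (M_ge0 n) (M_sum n) (M_up n) (iter_up hz).
  have fE (G : state z -> R) : \sum_phi [ffun phi => p phi] phi * G phi = \sum_phi p phi * G phi.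
    by apply: eq_bigr => phi _; rewrite ffunE.
  exists [ffun phi => p phi]; split.
    split=> [phi||phi]; first by rewrite ffunE.
      by rewrite -p_sum; apply: eq_bigr => phi _; rewrite ffunE.
    by rewrite fE ffunE.
  move=> q [_ q_sum qM]; apply/ffunP => phi; rewrite ffunE.
  exact: (stationary_unique (M_ge0 n) (M_sum n) (M_up n) (iter_up hz)).
- move=> p p_stat.
  pose a n k := mean_age (M n) (fun phi => level phi k != 1%N)
    (@state_prob _ _ _ P z beta gamma n).
  (* Some of the four limits may be [+oo]; nonnegativity allows the limit to be taken term by term
     in the extended reals. *)
  have a_ge0 (n k : 'I_2) (N : nat) :
      (0 <= (N%:R^-1 * \sum_(1 <= t < N.+1) a n k t)%:E)%E.
    rewrite lee_fin mulr_ge0 ?invr_ge0 ?sumr_ge0// => t _.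
    apply: sumr_ge0 => j _; apply: sumr_ge0 => phi _.
    by rewrite mulr_ge0 ?pr_ge0 ?survival_ge0.
  (* At each finite time all means are real numbers, so the time average can be exchanged with the
     sums over [n] and [k] before the limit. *)
  rewrite [X in X @ _ --> _](_ : _ = fun N : nat => ((4^-1)%:E *
      \sum_(n < 2) \sum_(k < 2) (N%:R^-1 * \sum_(1 <= t < N.+1) a n k t)%:E)%E); last first.
    apply/funext => N; rewrite /average_age.
    under eq_bigr do under eq_bigr do under eq_bigr do
      rewrite (expected_age hb1 hz hnet).
    under eq_bigr do under eq_bigr do rewrite sumEFin.
    under eq_bigr do rewrite sumEFin -EFinM.
    rewrite sumEFin -EFinM.
    under [in RHS]eq_bigr do rewrite sumEFin.
    rewrite sumEFin -EFinM; congr EFin.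
    rewrite -mulr_sumr mulrCA; congr (_ * _).
    rewrite exchange_big mulr_sumr; apply: eq_bigr => n _.
    by rewrite exchange_big mulr_sumr.
  apply: cvgeZl => //; apply: cvg_nnesum => n _.
    by apply: nearW => N; apply: sume_ge0 => k _; exact: a_ge0.
  apply: cvg_nnesum => k _.
    by apply: nearW => N; exact: a_ge0.
  apply: cvg_mean_age => //.
  + by move=> t phi; exact: state_prob_ge0.
  + by move=> t; exact: (sum_state_prob hz hnet).
  + exact: (state_probS hb1 hz hnet).
Qed.
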